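(* Let $k$ be a field of characteristic $0$, let $(d,n)\in\{(2,12),(2,13),(3,9)\}$, and let $r\ge 1$ be an integer. If $f_1,\ldots,f_r\in k[x_1,\ldots,x_n]$ are generic forms of degree $d$, then the Hilbert series of $R=k[x_1,\ldots,x_n]/(f_1,\ldots,f_r)$ is $$H_R(t)=\left[\frac{(1-t^d)^r}{(1-t)^n}\right].$$
   Context: The polynomial ring $k[x_1,\ldots,x_n]$ has the standard grading ($\deg x_i=1$). For a graded quotient $R=\bigoplus_{i\ge 0}R_i$ of it by a homogeneous ideal, the Hilbert series is $H_R(t)=\sum_{i\ge 0}\dim_k(R_i)\,t^i$. Bracket notation: for a formal power series $\sum_{i\ge 0}a_it^i$ with integer coefficients, $\left[\sum_{i\ge 0}a_it^i\right]=\sum_{i\ge 0}b_it^i$, where $b_i=a_i$ if $a_j>0$ for all $j\le i$, and $b_i=0$ otherwise. Generic forms: an $r$-tuple $(f_1,\ldots,f_r)$ of forms of degree $d$ in $n$ variables is identified, via the coefficients of all monomials of degree $d$, with a point of the affine space $\mathbb{A}^N_k=k^N$, where $N=r\binom{n+d-1}{d}$. For $k$ infinite, there is a nonempty Zariski open subset of $\mathbb{A}^N_k$ on which the Hilbert series of $k[x_1,\ldots,x_n]/(f_1,\ldots,f_r)$ is constant (and equal to the smallest series among algebras of this form). Saying that generic forms of degree $d$ have a given Hilbert series means that this constant value is the given series, i.e. that there is a nonempty Zariski open subset of $\mathbb{A}^N_k$ such that every $(f_1,\ldots,f_r)$ in it gives a quotient with that Hilbert series. *)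

(* Defs.v *)
From HB Require Import structures.
From mathcomp Require Import all_boot all_order all_algebra.
From mathcomp.multinomials Require Export mpoly.

Set Implicit Arguments.
Unset Strict Implicit.
Unset Printing Implicit Defensive.

Import Order.TTheory GRing.Theory Num.Theory.
Local Open Scope ring_scope.

(* A formal power series is represented by its sequence of coefficients. *)
Definition fps (R : Type) := nat -> R.

Definition fps_of_poly (R : nzRingType) (p : {poly R}) : fps R := fun i => p`_i.

Definition fps_mul (R : nzRingType) (a b : fps R) : fps R :=
  fun i => \sum_(j < i.+1) a j * b (i - j)%N.

(* The coefficients c_0, ..., c_(m-1) of the inverse of a, obtained by solving *)
(* \sum_(j <= i) a_(i - j) * c_j = (i == 0) for c_i.                          *)
Fixpoint fps_inv_seq (R : unitRingType) (a : fps R) (m : nat) : seq R :=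
  if m is i.+1 then
    let s := fps_inv_seq a i in
    rcons s ((a 0%N)^-1 * ((i == 0%N)%:R - \sum_(j < i) a (i - j)%N * s`_j))
  else [::].

(* Only meaningful when the constant coefficient is a unit: see fps_mulV. *)
Definition fps_inv (R : unitRingType) (a : fps R) : fps R :=
  fun i => (fps_inv_seq a i.+1)`_i.

Definition fps_div (R : unitRingType) (a b : fps R) : fps R :=
  fps_mul a (fps_inv b).

Lemma size_fps_inv_seq (R : unitRingType) (a : fps R) m :
  size (fps_inv_seq a m) = m.
Proof. by elim: m => //= m IHm; rewrite size_rcons IHm. Qed.

Lemma nth_fps_inv_seq (R : unitRingType) (a : fps R) m j :
  (j < m)%N -> (fps_inv_seq a m)`_j = fps_inv a j.
Proof.
elim: m => // m IHm; rewrite ltnS leq_eqVlt => /predU1P[-> // | ltjm].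
by rewrite /= nth_rcons size_fps_inv_seq ltjm IHm.
Qed.

Lemma fps_mulV (R : comUnitRingType) (a : fps R) :
  a 0%N \is a GRing.unit -> fps_mul a (fps_inv a) =1 fps_of_poly 1.
Proof.
move=> ua i; rewrite /fps_mul /fps_of_poly coef1 big_ord_recl /= subn0.
rewrite {1}/fps_inv /= nth_rcons size_fps_inv_seq ltnn eqxx mulrA divrr // mul1r.
set s := (X in _ - X + _); set t := (X in _ + X); suff -> : t = s by rewrite subrK.
rewrite {}/s {}/t (reindex_inj rev_ord_inj); apply: eq_bigr => j _.
by rewrite nth_fps_inv_seq //= /bump add1n subnSK // subKn // ltnW.
Qed.

Definition bracket (a : fps int) : fps int :=
  fun i => if [forall j : 'I_i.+1, 0 < a j] then a i else 0.

Definition in_ideal (k : fieldType) (n r : nat) (f : 'I_r -> {mpoly k[n]})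
    (p : {mpoly k[n]}) : Prop :=
  exists g : 'I_r -> {mpoly k[n]}, p = \sum_(j < r) g j * f j.

(* For a homogeneous ideal I and R = k[x_1, ..., x_n] / I: dim_k R_i = m, i.e. *)
(* R_i has a basis consisting of the classes mod I of m forms of degree i.    *)
Definition quotient_dim (k : fieldType) (n : nat) (I : {mpoly k[n]} -> Prop)
    (i m : nat) : Prop :=
  exists b : 'I_m -> {mpoly k[n]},
  [/\ forall l, b l \is i.-homog,
      forall p, p \is i.-homog ->
        exists c : 'I_m -> k, I (p - \sum_(l < m) c l *: b l)
    & forall c : 'I_m -> k,
        I (\sum_(l < m) c l *: b l) -> forall l, c l = 0].

Definition is_hilbert_series (k : fieldType) (n : nat)
    (I : {mpoly k[n]} -> Prop) (H : fps int) : Prop :=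
  forall i, exists2 m : nat, quotient_dim I i m & H i = m%:Z.

Definition zariski_open (k : fieldType) (N : nat) (U : 'rV[k]_N -> Prop) :
    Prop :=
  exists S : {mpoly k[N]} -> Prop,
    forall x, U x <-> exists2 p, S p & p.@[x 0] != 0.

Definition monomials (n d : nat) : seq 'X_{1..n} :=
  [seq bmnm m | m : 'X_{1..n < d.+1} <- enum {: 'X_{1..n < d.+1}} & mdeg m == d].

Lemma mem_monomials n d m : (m \in monomials n d) = (mdeg m == d).
Proof.
apply/mapP/idP => [[m' + ->] | dm]; first by rewrite mem_filter => /andP[].
have lt_md : (mdeg m < d.+1)%N by rewrite (eqP dm).
by exists (BMultinom lt_md); rewrite // mem_filter mem_enum andbT.
Qed.

Lemma uniq_monomials n d : uniq (monomials n d).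
Proof.
rewrite map_inj_uniq; first exact: filter_uniq (enum_uniq _).
exact: (@val_inj _ _ 'X_{1..n < d.+1}).
Qed.

Lemma size_monomials n d : size (monomials n d) = 'C(n + d - 1, d).
Proof.
case: n => [|n]; last first.
  rewrite addSn subn1 /= addnC -size_basis.
  apply/perm_size/uniq_perm; rewrite ?uniq_monomials ?uniq_basis // => m.
  by rewrite mem_monomials basis_cover.
have m0 (m : 'X_{1..0}) : m = 0%MM by apply/mnmP => -[].
case: d => [|d]; last first.
  rewrite add0n subn1 /= bin_small //; case def_s: (monomials 0 d.+1) => [|m s] //.
  have: m \in monomials 0 d.+1 by rewrite def_s mem_head.
  by rewrite mem_monomials (m0 m) mdeg0.
rewrite bin0 -[RHS]/(size [:: 0%MM : 'X_{1..0}]).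
apply/perm_size/uniq_perm; rewrite ?uniq_monomials // => m.
by rewrite mem_monomials (m0 m) mdeg0 mem_head.
Qed.

(* The r-tuple of forms of degree d whose coefficients are the coordinates of  *)
(* the point x of the affine space k^N, N = r * 'C(n + d - 1, d).              *)
Definition forms_of_point (k : fieldType) (n d r : nat)
    (x : 'rV[k]_(r * 'C(n + d - 1, d))) : 'I_r -> {mpoly k[n]} :=
  fun j => \sum_(l < 'C(n + d - 1, d))
             vec_mx x j l *: 'X_[nth 0%MM (monomials n d) l].

Definition generic_forms (k : fieldType) (n d r : nat)
    (P : ('I_r -> {mpoly k[n]}) -> Prop) : Prop :=
  exists U : 'rV[k]_(r * 'C(n + d - 1, d)) -> Prop,
  [/\ zariski_open U, exists x, U x
    & forall x, U x -> P (forms_of_point x)].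

(* Main.v *)
(* Write h(s, i) for the dimension in degree i of the quotient by the first s  *)
(* forms, and a(s, i) for the coefficient of t^i in (1 - t^d)^s / (1 - t)^n.   *)
(* Multiplication by the next form gives h(s, i) <= h(s + 1, i) + h(s, i - d), *)
(* while a(s, i) = a(s + 1, i) + a(s, i - d). Hence the upper bounds           *)
(* h(r, i) <= a(r, i) for i < D already force h(s, i) = a(s, i) for all        *)
(* s <= r and i < D. An upper bound on h is an open condition on the forms, so *)
(* it is enough to exhibit one sample for each of finitely many pairs (r, i):  *)
(* in each degree i, the largest r with a(r, i) >= 0, and the first r for      *)
(* which the quotient should vanish in degree i. When r <= n the powers x_j^d  *)
(* are samples in all degrees.                                                 *)
(*                                                                             *)
(* For r > n the samples have integer coefficients, and their Macaulay         *)
(* matrices are bounded below in rank by elimination over F_2. The first n     *)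
(* forms define a quotient with a basis of monomials in which a product of two *)
(* basis elements is a basis element or 0; this quotient has the Hilbert       *)
(* function of k[x_1, ..., x_n]/(x_1^d, ..., x_n^d). The squares x_j^2         *)
(* themselves cannot be used for d = 2, because mod 2 they would make the      *)
(* square of every quadratic form vanish. The remaining forms are homogeneous  *)
(* for an additional grading by Z/g, so that the matrices split into g blocks. *)

(* Add the forms one at a time. Multiplication by the next form gives the right exact sequence
   behind [hdim_step], and multiplication by 1 - t^d gives the matching recursion [hcoefS].
   Comparing them, [hdim_exact] turns upper bounds for the last quotient into the exact Hilbert
   function of all intermediate ones. If moreover the quotient by r forms vanishes in degree D, then
   [hdim_geq] gives a(r, D) <= 0, so the bracket has cut the series by then, and the vanishing
   propagates upwards ([hdim_eq0_leq]).

   Upper bounds are open conditions ([hdim_open]) and nonempty open sets meet over an infinite field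
   ([nonvanishing_mul]), so each degree may use its own sample ([generic_hdim]). Attaining a(r, i)
   passes to fewer forms, vanishing to more forms. For r > n, [froberg_table] takes the first degree
   i where the largest good number R i is below r: in lower degrees r <= R j, and in degree i
   already S i <= R i + 1 <= r forms leave nothing. The search stops at the degree D where n + 1
   forms suffice. For r <= n, [froberg_small] completes the forms by powers of variables.

   The remaining ranks are computed. By [sample_attains] the computed corank bounds the dimension:
   basis monomials span the quotient ([mpolyX_codes], [hdim_le_blocks]), the rows lift to integer
   relations ([product_row_spec]), and reduction mod 2 cannot raise the rank ([mxrank_mod2]). *)
From Stdlib Require Import BinNat BinInt.
From HB Require Import structures.
Require Import Defs.
From mathcomp Require Import all_boot all_order all_algebra.
From mathcomp.multinomials Require Import mpoly.
From mathcomp Require Import zify ring ssrZ.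
Set Implicit Arguments.
Unset Strict Implicit.
Unset Printing Implicit Defensive.
Import Order.TTheory GRing.Theory Num.Theory.
Local Open Scope ring_scope.

(** * Hilbert function coefficients *)

(* The a(r, i) of the header. *)
Definition hcoef (n d r : nat) : fps int :=
  fps_div (fps_of_poly ((1 - 'X^d) ^+ r)) (fps_of_poly ((1 - 'X) ^+ n)).

(** Turns the recursively defined [fps_inv] into a closed form: a candidate inverse is recognised by
    multiplying back. *)
Lemma fps_mul_cancel (R : nzRingType) (w x y : fps R) :
  w 0%N = 1 -> fps_mul w x =1 fps_mul w y -> x =1 y.
Proof.
move=> w0 wxy i; elim/ltn_ind: i => i IHi.
have:= wxy i; rewrite /fps_mul !big_ord_recl w0 !mul1r !subn0.
suff -> : \sum_(j < i) w (lift ord0 j) * x (i - lift ord0 j)%N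
        = \sum_(j < i) w (lift ord0 j) * y (i - lift ord0 j)%N by move/addIr.
apply: eq_bigr => j _; rewrite IHi // lift0 ltn_subrL /=.
by rewrite (leq_ltn_trans _ (ltn_ord j)).
Qed.

Lemma fps_mul_poly (R : nzRingType) (p q : {poly R}) i :
  fps_mul (fps_of_poly p) (fps_of_poly q) i = (p * q)`_i.
Proof. by rewrite /fps_mul /fps_of_poly coefM. Qed.

Lemma fps_mul_take (R : nzRingType) (a b c : fps R) i :
  (forall j, (j <= i)%N -> b j = c j) -> fps_mul a b i = fps_mul a c i.
Proof. by move=> bc; apply: eq_bigr => j _; rewrite bc // leq_subr. Qed.

(** The bound m truncates 1/(1 - t)^(n+1) to a polynomial; the induction on n is Pascal's rule. *)
Lemma mul_sub1X_bin (n m i : nat) : (i < m)%N ->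
  ((1 - 'X) ^+ n.+1 * \poly_(j < m) ('C((n + j)%N, j))%:R)`_i = (i == 0%N)%:R :> int.
Proof.
elim: n i => [|n IHn] i ltim.
  rewrite expr1 mulrBl mul1r coefB coefXM !coef_poly ltim !add0n. rewrite !binn.
  by case: i ltim => [|i] ltim //=; rewrite (ltnW ltim) subrr.
rewrite exprSr -mulrA; rewrite -IHn // !coefM; apply: eq_bigr => j _.
congr (_ * _); have: (i - j < m)%N by rewrite (leq_ltn_trans (leq_subr _ _)).
move: (i - j)%N => l ltlm.
rewrite mulrBl mul1r coefB coefXM !coef_poly ltlm.
case: l ltlm => [|l] ltlm /=; first by rewrite !bin0 subr0.
by rewrite (ltnW ltlm) addSn binS addSnnS natrD addrK.
Qed.

Lemma inv_sub1X_exp (n i : nat) :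
  fps_inv (fps_of_poly ((1 - 'X) ^+ n.+1)) i = 'C((n + i)%N, i)%:R :> int.
Proof.
have w0 : fps_of_poly ((1 - 'X) ^+ n.+1 : {poly int}) 0%N = 1.
  by rewrite /fps_of_poly -horner_coef0 horner_exp !hornerE ?subr0 ?expr1n.
move: i; apply: (fps_mul_cancel w0) => i; rewrite fps_mulV ?w0 ?unitr1 //.
rewrite /fps_of_poly coef1 -(@mul_sub1X_bin n i.+1) // -fps_mul_poly.
by apply: fps_mul_take => j leji; rewrite /fps_of_poly coef_poly ltnS leji.
Qed.

Lemma hcoef0 (n d i : nat) : hcoef n.+1 d 0 i = 'C((n + i)%N, i)%:R.
Proof.
rewrite /hcoef /fps_div /fps_mul big_ord_recl expr0 /fps_of_poly coef1 mul1r.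
rewrite big1 ?addr0 ?subn0 ?inv_sub1X_exp //.
by move=> j _; rewrite coef1 mul0r.
Qed.

(** The numerator is multiplied by 1 - t^d. This is the numerical counterpart of [hdim_step]. *)
Lemma hcoefS (n d r i : nat) :
  hcoef n d r.+1 i = hcoef n d r i - (if (d <= i)%N then hcoef n d r (i - d)%N else 0).
Proof.
rewrite /hcoef /fps_div; set w := fps_inv _; set p := (_ ^+ r).
rewrite exprSr -/p /fps_mul /fps_of_poly.
rewrite (eq_bigr (fun j : 'I_i.+1 => p`_j * w (i - j)%N
   - (if (d <= j)%N then p`_(j - d)%N * w (i - j)%N else 0))); last first.
  move=> j _; rewrite mulrBr mulr1 coefB coefMXn mulrBl ltnNge.
  by case: (d <= j)%N; rewrite //= mul0r.
rewrite sumrB; congr (_ - _).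
rewrite -big_mkcond /= -(big_mkord (fun j => (d <= j)%N) (fun j => p`_(j - d)%N * w (i - j)%N)).
case: leqP => ledi; last first.
  by rewrite big_nat_cond big_pred0 // => j; apply/negP; lia.
rewrite (big_cat_nat (n := d)) //=; last lia.
rewrite big_nat_cond big_pred0 ?add0r; last by move=> j; apply/negP; lia.
rewrite -{1}[d]add0n big_addn (_ : (i.+1 - d = (i - d).+1)%N); last lia.
rewrite (eq_bigl xpredT); last by move=> j /=; lia.
rewrite big_mkord; apply: eq_bigr => j _.
by rewrite addnK; congr (_ * w _); lia.
Qed.

(** * Graded pieces of an ideal *)

Definition ndim (n i : nat) : nat := 'C(n + i - 1, i).

Definition mon (n i : nat) (l : 'I_(ndim n i)) : 'X_{1..n} :=
  nth 0%MM (monomials n i) l.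

Lemma mon_mem n i l : @mon n i l \in monomials n i.
Proof. by rewrite mem_nth // size_monomials. Qed.

Lemma mdeg_mon n i l : mdeg (@mon n i l) = i.
Proof. by apply/eqP; rewrite -mem_monomials mon_mem. Qed.

Lemma mon_inj n i : injective (@mon n i).
Proof.
move=> l l' /eqP; rewrite nth_uniq ?size_monomials ?uniq_monomials //.
by move/eqP/val_inj.
Qed.

Lemma monP n i (m : 'X_{1..n}) : mdeg m = i -> exists l, @mon n i l = m.
Proof.
move/eqP; rewrite -mem_monomials => m_in.
have lt_m : (index m (monomials n i) < ndim n i)%N by rewrite /ndim -size_monomials index_mem.
by exists (Ordinal lt_m); apply: nth_index.
Qed.

Section CoefficientVectors.
Variables (k : fieldType) (n : nat).
Implicit Types (p q f : {mpoly k[n]}) (i : nat).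

Definition cvec i p : 'rV[k]_(ndim n i) := \row_l p@_(mon l).
Definition vpoly i (v : 'rV[k]_(ndim n i)) : {mpoly k[n]} := \sum_l v 0 l *: 'X_[mon l].

Fact cvec_is_linear i : linear (cvec i).
Proof. by move=> c p q; apply/rowP=> l; rewrite !mxE mcoeffD mcoeffZ. Qed.
HB.instance Definition _ i :=
  GRing.isLinear.Build k {mpoly k[n]} 'rV[k]_(ndim n i) _ (cvec i) (cvec_is_linear i).

Lemma vpolyK i : cancel (@vpoly i) (cvec i).
Proof.
move=> v; apply/rowP=> l; rewrite mxE raddf_sum (bigD1 l) //= big1.
  by rewrite addr0 mcoeffZ mcoeffX eqxx mulr1.
by move=> l' nel; rewrite mcoeffZ mcoeffX (inj_eq (@mon_inj _ _)) (negPf nel) mulr0.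
Qed.

Lemma mpolyX_mon_homog i l : ('X_[@mon n i l] : {mpoly k[n]}) \is i.-homog.
Proof. by rewrite dhomogX /=; apply/eqP/mdeg_mon. Qed.

Lemma vpoly_homog i v : @vpoly i v \is i.-homog.
Proof. by apply: rpred_sum => l _; rewrite rpredZ ?mpolyX_mon_homog. Qed.

Lemma cvec_homog_inj i p q :
  p \is i.-homog -> q \is i.-homog -> cvec i p = cvec i q -> p = q.
Proof.
move=> hp hq epq; apply/mpolyP=> m; have [dm|ndm] := eqVneq (mdeg m) i.
  by have [l <-] := monP dm; move/rowP/(_ l): epq; rewrite !mxE.
by rewrite (dhomog_nemf_coeff hp) // (dhomog_nemf_coeff hq).
Qed.

Lemma cvecK i p : p \is i.-homog -> vpoly (cvec i p) = p.
Proof. by move=> hp; apply: (@cvec_homog_inj i); rewrite ?vpolyK ?vpoly_homog. Qed.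

Lemma vpoly_eq_sum i p : p \is i.-homog -> p = \sum_l p@_(@mon n i l) *: 'X_[mon l].
Proof. by move/cvecK=> {1}<-; apply: eq_bigr => l _; rewrite mxE. Qed.

Variable d : nat.

(* For i < d the row index i - d is truncated to 0; the matrix is then zero,   *)
(* see mulform_lt.                                                             *)
Definition mulform i f : 'M[k]_(ndim n (i - d), ndim n i) :=
  \matrix_l cvec i ('X_[mon l] * f).

Lemma mulform_vpoly i f v : v *m mulform i f = cvec i (vpoly v * f).
Proof.
rewrite mulmx_sum_row mulr_suml raddf_sum; apply: eq_bigr => l _ /=.
by rewrite rowK -scalerAl linearZ.
Qed.

Lemma cvec_homog_ne i e p : p \is e.-homog -> e != i -> cvec i p = 0.
Proof.
move=> hp nei; apply/rowP=> l; rewrite !mxE (dhomog_nemf_coeff hp) //.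
by move: (mdeg_mon l) => /= ->; rewrite eq_sym.
Qed.

Lemma cvec_mul_sub i f g : f \is d.-homog -> (cvec i (g * f)%R <= mulform i f)%MS.
Proof.
move=> hf; rewrite [g]mpolyE mulr_suml linear_sum summx_sub // => m _.
rewrite -scalerAl linearZ scalemx_sub //=.
have hm : 'X_[m] * f \is (mdeg m + d).-homog by rewrite dhomogM ?dhomogX.
have [dm|ne] := eqVneq (mdeg m + d)%N i; last by rewrite (cvec_homog_ne hm) ?sub0mx.
have [|l <-] := @monP n (i - d) m; first by rewrite -dm addnK.
by rewrite -[cvec _ _](rowK (fun l => cvec i ('X_[mon l] * f))) row_sub.
Qed.

Lemma mulform_lt i f : f \is d.-homog -> (i < d)%N -> mulform i f = 0.
Proof.
move=> hf ltid; apply/row_matrixP=> l; rewrite rowK row0.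
apply: (@cvec_homog_ne _ (i - d + d)); last by lia.
by rewrite dhomogM ?mpolyX_mon_homog.
Qed.

Implicit Types F : nat -> {mpoly k[n]}.

(** Row space of the Macaulay matrix in degree i. The [<<_>>] makes the summands square, as iterated
    sums of row spaces require. *)
Definition idl F s i : 'M[k]_(ndim n i) :=
  (\sum_(j < s) <<mulform i (F j)>>)%MS.

Definition hdim F s i : nat := (ndim n i - \rank (idl F s i))%N.

Lemma idlP F s i p : (forall j, F j \is d.-homog) -> p \is i.-homog ->
  in_ideal (fun j : 'I_s => F j) p <-> (cvec i p <= idl F s i)%MS.
Proof.
move=> hf hp; split=> [[g ->]|].
  rewrite linear_sum summx_sub_sums // => j _.
  by rewrite genmxE cvec_mul_sub.
case/sub_sums_genmxP=> u def_p.
(* For i < d the rows of [mulform] are indexed by monomials of degree 0 and cannot be read back as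
   multipliers of degree i - d; but they vanish, so p = 0. *)
have [ltid|ledi] := ltnP i d.
  have -> : p = 0.
    apply: (@cvec_homog_inj i) => //; first exact: dhomog0.
    by rewrite def_p linear0 big1 // => j _; rewrite mulform_lt ?mulmx0.
  by exists (fun=> 0); rewrite big1 // => j _; rewrite mul0r.
exists (fun j => vpoly (u j)); apply: (@cvec_homog_inj i) => //.
  apply: rpred_sum => j _; have := dhomogM (vpoly_homog (u j)) (hf j).
  by rewrite subnK.
by rewrite def_p linear_sum; apply: eq_bigr => j _; rewrite mulform_vpoly.
Qed.

(** The basis is read off a complement W of the degree i part of the ideal. *)
Lemma quotient_dim_hdim F s i : (forall j, F j \is d.-homog) ->
  quotient_dim (in_ideal (fun j : 'I_s => F j)) i (hdim F s i).
Proof.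
move=> hf; set V := idl F s i; rewrite /hdim -/V -mxrank_compl.
set W := V^C%MS; set b := fun l => vpoly (row l (row_base W)).
have sumb (c : 'I_(\rank W) -> k) :
    cvec i (\sum_l c l *: b l) = (\row_l c l) *m row_base W.
  rewrite mulmx_sum_row linear_sum; apply: eq_bigr => l _.
  by rewrite linearZ /= vpolyK mxE.
have homb c : \sum_l c l *: b l \is i.-homog.
  by apply: rpred_sum => l _; rewrite rpredZ ?vpoly_homog.
exists b; split=> [l|p hp|c].
- exact: vpoly_homog.
- have /sub_addsmxP[[u v] /= def_p] : (cvec i p <= V + W)%MS.
    by rewrite submx_full ?addsmx_compl_full.
  have /submxP[c def_c] : (v *m W <= row_base W)%MS by rewrite eq_row_base submxMl.
  exists (fun l => c 0 l); apply/(@idlP F s i) => //; first by apply: rpredB (homb _).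
  have row_c : \row_l c 0 l = c by apply/rowP=> l; rewrite mxE.
  by rewrite linearB /= sumb row_c def_p def_c addrK submxMl.
- move=> /(@idlP F s i) => /(_ hf (homb c)); rewrite sumb => cV l.
  have: (\row_l c l *m row_base W <= V :&: W)%MS.
    by rewrite sub_capmx cV -(eq_row_base W) submxMl.
  rewrite capmx_compl submx0 => /eqP c0.
  have: \row_l c l *m row_base W = 0 *m row_base W by rewrite c0 mul0mx.
  by move/(row_free_inj (row_base_free W))/rowP/(_ l); rewrite !mxE.
Qed.

Lemma hdim0 F i : hdim F 0 i = ndim n i.
Proof. by rewrite /hdim /idl big_ord0 mxrank0 subn0. Qed.

Lemma idlS F s i : (idl F s.+1 i :=: idl F s i + mulform i (F s))%MS.
Proof.
rewrite /idl big_ord_recr /=; exact: adds_eqmx (eqmx_refl _) (genmxE _).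
Qed.

Lemma hdimS_le F s i : (hdim F s.+1 i <= hdim F s i)%N.
Proof. by rewrite /hdim idlS leq_sub2l // mxrankS // addsmxSl. Qed.

Lemma hdim_leq_r F s s' i : (s <= s')%N -> (hdim F s' i <= hdim F s i)%N.
Proof.
move/subnKC <-; elim: (s' - s)%N => [|j IHj]; first by rewrite addn0.
by rewrite addnS (leq_trans (hdimS_le _ _ _)).
Qed.

Lemma cvec_in_idl F s i p : (forall j, F j \is d.-homog) ->
  in_ideal (fun j : 'I_s => F j) p -> (cvec i p <= idl F s i)%MS.
Proof.
move=> hF [g ->]; rewrite linear_sum summx_sub_sums // => j _.
by rewrite genmxE cvec_mul_sub.
Qed.

Lemma idl_mul F s i g : (forall j, F j \is d.-homog) ->
  (idl F s (i - d) *m mulform i g <= idl F s i)%MS.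
Proof.
move=> hF; apply/row_subP=> l; rewrite row_mul mulform_vpoly.
apply: cvec_in_idl => //.
have /(idlP _ hF (vpoly_homog _))[h ->] :
    (cvec (i - d) (vpoly (row l (idl F s (i - d)))) <= idl F s (i - d))%MS.
  by rewrite vpolyK row_sub.
exists (fun j => h j * g); rewrite mulr_suml; apply: eq_bigr => j _.
by rewrite -!mulrA [F j * g]mulrC.
Qed.

(** Multiplying the ideal of the first s forms by [F s] gives nothing new ([idl_mul]), so only a
    complement of it in degree i - d, of dimension h(s, i - d), can enlarge the ideal in degree
    i. *)
Lemma hdim_step F s i : (forall j, F j \is d.-homog) -> (d <= i)%N ->
  (hdim F s i <= hdim F s.+1 i + hdim F s (i - d))%N.
Proof.
move=> hF ledi; rewrite /hdim.
set K := idl F s (i - d); set M := mulform i (F s).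
have: (idl F s.+1 i <= idl F s i + K^C *m M)%MS.
  rewrite idlS addsmx_sub addsmxSl /= -/M -{1}[M]mul1mx.
  have sub1 : (1%:M *m M <= (K + K^C)%MS *m M)%MS.
    by rewrite submxMr // submx_full ?addsmx_compl_full.
  apply: submx_trans sub1 _.
  by rewrite addsmxMr addsmxS // idl_mul.
move/mxrankS => le1; have [le2 _] := mxrank_adds_leqif (idl F s i) (K^C%MS *m M).
have le3 := mxrankM_maxl K^C%MS M; have rkC := mxrank_compl K.
have le4 := rank_leq_col (idl F s.+1 i).
lia.
Qed.

Lemma hdim_lt F s i : (forall j, F j \is d.-homog) -> (i < d)%N -> hdim F s i = ndim n i.
Proof.
move=> hF ltid; rewrite /hdim /idl big1 ?mxrank0 ?subn0 // => j _.
by rewrite mulform_lt // genmx0.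
Qed.

Lemma hdim_eq0P F s i : (forall j, F j \is d.-homog) ->
  hdim F s i = 0%N <-> (forall p, p \is i.-homog -> in_ideal (fun j : 'I_s => F j) p).
Proof.
move=> hF; split=> [/eqP|inI].
  rewrite /hdim subn_eq0 => full p hp; apply/(idlP _ hF hp).
  by rewrite submx_full // /row_full eqn_leq rank_leq_col.
apply/eqP; rewrite /hdim subn_eq0 -[X in (X <= _)%N](mxrank1 k) mxrankS //.
apply/row_subP=> l; rewrite -[row l _]vpolyK; apply: cvec_in_idl => //.
exact/inI/vpoly_homog.
Qed.

End CoefficientVectors.

Section IdealClosure.
Variables (k : fieldType) (n r : nat) (f : 'I_r -> {mpoly k[n]}).
Implicit Types p q : {mpoly k[n]}.

Lemma in_ideal0 : in_ideal f 0.
Proof. by exists (fun=> 0); rewrite big1 // => j _; rewrite mul0r. Qed.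

Lemma in_idealD p q : in_ideal f p -> in_ideal f q -> in_ideal f (p + q).
Proof.
move=> [g ->] [h ->]; exists (fun j => g j + h j); rewrite -big_split.
by apply: eq_bigr => j _; rewrite mulrDl.
Qed.

Lemma in_idealM p q : in_ideal f q -> in_ideal f (p * q).
Proof.
move=> [g ->]; exists (fun j => p * g j); rewrite mulr_sumr.
by apply: eq_bigr => j _; rewrite mulrA.
Qed.

Lemma in_idealN p : in_ideal f p -> in_ideal f (- p).
Proof. by rewrite -mulN1r; exact: in_idealM. Qed.

Lemma in_idealB p q : in_ideal f p -> in_ideal f q -> in_ideal f (p - q).
Proof. by move=> fp fq; apply/in_idealD/in_idealN. Qed.

Lemma in_idealZ c p : in_ideal f p -> in_ideal f (c *: p).
Proof. by rewrite -mul_mpolyC; exact: in_idealM. Qed.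

Lemma in_ideal_sum (I : Type) (s : seq I) (P : pred I) (F : I -> {mpoly k[n]}) :
  (forall i, P i -> in_ideal f (F i)) -> in_ideal f (\sum_(i <- s | P i) F i).
Proof.
move=> fF; elim/big_ind: _ => //; [exact: in_ideal0 | exact: in_idealD].
Qed.

Lemma in_ideal_gen j : in_ideal f (f j).
Proof.
exists (fun i => (i == j)%:R); rewrite (bigD1 j) //= eqxx mul1r big1 ?addr0 //.
by move=> i /negPf ->; rewrite mul0r.
Qed.
End IdealClosure.

Lemma mnm_split n (m : 'X_{1..n}) i : (i <= mdeg m)%N ->
  exists m1 m2 : 'X_{1..n}, m = (m1 + m2)%MM /\ mdeg m1 = i.
Proof.
elim: i => [|i IHi] lti; first by exists 0%MM, m; rewrite add0m mdeg0.
have [m1 [m2 [def_m dm1]]] := IHi (ltnW lti).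
have m2n0 : m2 != 0%MM by apply: contraTneq lti => m20; rewrite def_m m20 addm0 dm1 ltnn.
have [v m2v] : exists v, m2 v != 0%N.
  apply/existsP; apply: contra_neqT m2n0; rewrite negb_exists => /forallP m2v.
  by apply/mnmP=> v; rewrite mnm0E; apply/eqP; rewrite -[_ == _]negbK.
exists (m1 + U_(v))%MM, (m2 - U_(v))%MM; rewrite mdegD mdeg1 dm1 addn1; split=> //.
by rewrite -addmA [(U_(v) + _)%MM]addmC submK ?def_m // lep1mP.
Qed.

(** Every monomial of degree j has a divisor of degree i ([mnm_split]). *)
Lemma hdim_eq0_leq (k : fieldType) (n d : nat) (F : nat -> {mpoly k[n]}) s i j :
  (forall j, F j \is d.-homog) -> (i <= j)%N ->
  hdim d F s i = 0%N -> hdim d F s j = 0%N.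
Proof.
move=> hF leij /(hdim_eq0P _ _ hF) inI; apply/(hdim_eq0P _ _ hF) => p hp.
rewrite (vpoly_eq_sum hp); apply: in_ideal_sum => l _; apply: in_idealZ.
have [|m1 [m2 [-> dm1]]] := @mnm_split _ (@mon n j l) i; first by rewrite mdeg_mon.
rewrite mpolyXD mulrC; apply: in_idealM; apply: inI.
by rewrite dhomogX /=; apply/eqP.
Qed.

Lemma hcoef0_ndim (n d i : nat) : (0 < n)%N -> hcoef n d 0 i = (ndim n i)%:R.
Proof. by case: n => // n _; rewrite hcoef0 /ndim addSn subn1. Qed.

Lemma hcoef_lt (n d r i : nat) : (0 < n)%N -> (i < d)%N -> hcoef n d r i = (ndim n i)%:R.
Proof.
move=> n0 ltid; elim: r => [|r IHr]; first exact: hcoef0_ndim.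
by rewrite hcoefS leqNgt ltid subr0.
Qed.

(** * Comparison of the Hilbert function with the coefficients a(s, i) *)

Section Exact.
Variables (k : fieldType) (n d : nat) (F : nat -> {mpoly k[n]}).
Hypotheses (n0 : (0 < n)%N) (d0 : (0 < d)%N) (hF : forall j, F j \is d.-homog).

(** Upper bounds descend: h(s, i) <= h(s+1, i) + h(s, i-d) <= a(s+1, i) + a(s, i-d) = a(s, i).
    Equality then ascends from the polynomial ring, s = 0: h(s+1, i) >= h(s, i) - h(s, i-d) = a(s+1,
    i). *)
Lemma hdim_exact R D :
  (forall i, (i <= D)%N -> (hdim d F R i)%:R <= hcoef n d R i) ->
  forall i s, (i <= D)%N -> (s <= R)%N -> (hdim d F s i)%:R = hcoef n d s i.
Proof.
move=> ubR.
have ub i : (i <= D)%N -> forall s, (s <= R)%N -> (hdim d F s i)%:R <= hcoef n d s i.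
  elim/ltn_ind: i => i IHi leiD s /subKn <-; elim: (R - s)%N => [|t IHt].
    by rewrite subn0 ubR.
  have [ltRt|leRt] := ltnP t R; last by move: IHt; rewrite (_ : R - t.+1 = R - t)%N //; lia.
  have def_t : (R - t = (R - t.+1).+1)%N by lia.
  rewrite def_t in IHt; move: (R - t.+1)%N (leq_subr t.+1 R) IHt => u leuR IHu.
  have [ltid|ledi] := ltnP i d; first by rewrite hdim_lt // hcoef_lt.
  have := hdim_step u hF ledi; rewrite -(ler_nat int) natrD => le1.
  have := IHi (i - d)%N _ _ u leuR; have -> : (i - d < i)%N by lia.
  have -> : (i - d <= D)%N by lia.
  by move: IHu; rewrite hcoefS ledi; lia.
move=> i s leiD; elim: s => [|s IHs] lesR; first by rewrite hdim0 hcoef0_ndim.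
apply/le_anti; rewrite ub //= hcoefS -(IHs (ltnW lesR)).
have [ltid|ledi] := ltnP i d; first by rewrite subr0 !hdim_lt.
have := hdim_step s hF ledi; have := ub (i - d)%N _ s (ltnW lesR).
have -> : (i - d <= D)%N by lia.
lia.
Qed.

(** The ascending half of [hdim_exact], carried into degree D, where no upper bound by a is
    available. It shows a(r, D) <= 0 once the quotient vanishes there. *)
Lemma hdim_geq R D :
  (forall i s, (i < D)%N -> (s <= R)%N -> (hdim d F s i)%:R = hcoef n d s i) ->
  forall s, (s <= R)%N -> hcoef n d s D <= (hdim d F s D)%:R.
Proof.
move=> eqR; elim=> [|s IHs] lesR; first by rewrite hdim0 hcoef0_ndim.
have [ltDd|ledD] := ltnP D d; first by rewrite hdim_lt // hcoef_lt.
have := hdim_step s hF ledD; have := eqR (D - d)%N s _ (ltnW lesR).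
have -> : (D - d < D)%N by lia.
by have := IHs (ltnW lesR); rewrite hcoefS ledD; lia.
Qed.
End Exact.

(** * Openness of rank conditions *)

Lemma poly_nonroot (k : fieldType) (p : {poly k}) :
  [pchar k] =i pred0 -> p != 0 -> exists t, p.[t] != 0.
Proof.
move=> chark p0; pose rs : seq k := [seq j%:R | j <- iota 0 (size p)].
have natk (j : nat) : (j%:R == 0 :> k) = (j == 0%N) by move/pcharf0P: chark.
have inj_nat : injective (fun j => j%:R : k).
  move=> i j /eqP; wlog leij : i j / (i <= j)%N => [th|].
    by case/orP: (leq_total i j) => le e; [apply: th | apply/esym/th; rewrite // eq_sym].
  by rewrite eq_sym -subr_eq0 -natrB // natk subn_eq0 => leji; apply/eqP; rewrite eqn_leq leij.
have /allPn[t _ nroot] : ~~ all (root p) rs.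
  apply/negP => /(max_poly_roots p0); rewrite map_inj_uniq ?iota_uniq //.
  by rewrite size_map size_iota ltnn => /(_ isT).
by exists t.
Qed.

Lemma horner_mmap (k : fieldType) N (h : 'I_N -> {poly k}) (p : {mpoly k[N]}) t :
  (mmap polyC h p).[t] = p.@[fun i => (h i).[t]].
Proof.
rewrite mevalE /mmap horner_sum; apply: eq_bigr => m _.
rewrite hornerM hornerC /mmap1 horner_prod; congr (_ * _).
by apply: eq_bigr => i _; rewrite horner_exp.
Qed.

(* Restrict p and q to the line through a and b. *)
Lemma nonvanishing_mul (k : fieldType) N (p q : {mpoly k[N]}) a b :
  [pchar k] =i pred0 -> p.@[a] != 0 -> q.@[b] != 0 -> exists c, (p * q).@[c] != 0.
Proof.
move=> chark pa qb; pose h i : {poly k} := (a i)%:P + (b i - a i) *: 'X.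
have h0 i : (h i).[0] = a i by rewrite !hornerE.
have h1 i : (h i).[1] = b i by rewrite hornerD hornerC hornerZ hornerX mulr1 addrC subrK.
have [|t] := @poly_nonroot _ (mmap polyC h p * mmap polyC h q) chark.
  apply: mulf_neq0; [apply: contraNneq pa | apply: contraNneq qb] => /(congr1 (fun r => r.[_])) H.
    by have := H 0; rewrite horner_mmap horner0 (meval_eq _ h0) => ->.
  by have := H 1; rewrite horner_mmap horner0 (meval_eq _ h1) => ->.
by rewrite hornerM !horner_mmap -mevalM; exists (fun i => (h i).[t]).
Qed.

Section Open.
Variables (k : fieldType) (n d N : nat) (P : nat -> 'I_(ndim n d) -> {mpoly k[N]}).
Hypothesis chark : [pchar k] =i pred0.

Definition form_at (x : 'I_N -> k) (j : nat) : {mpoly k[n]} :=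
  \sum_l (P j l).@[x] *: 'X_[mon l].

Lemma mulform_form_at i x j :
  mulform d i (form_at x j) = \sum_l (P j l).@[x] *: mulform d i 'X_[mon l].
Proof.
apply/row_matrixP=> a; rewrite rowK linear_sum mulr_sumr linear_sum.
by apply: eq_bigr => l _; rewrite -scalerAr !linearZ /= rowK.
Qed.

Lemma hdim_open s i x0 : exists2 p : {mpoly k[N]}, p.@[x0] != 0 &
  forall x, p.@[x] != 0 -> (hdim d (form_at x) s i <= hdim d (form_at x0) s i)%N.
Proof.
(* A minor that does not vanish at x0, as a polynomial in the parameters. *)
set V := idl d (form_at x0) s i.
have /row_freeP[R VR] := row_base_free V.
have /sub_sums_genmxP[u def_u] : (row_base V <= V)%MS by rewrite eq_row_base.
(* The constant multipliers u express a basis of V through the rows at x0, and R is a right inverse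
   of that basis. Hence Q is the identity at x0, and wherever Q is invertible the ideal has at least
   the rank of V. *)
pose Q : 'M[{mpoly k[N]}]_(\rank V) :=
  \sum_(j < s) \sum_l P j l *: map_mx (@mpolyC N k) (u j *m mulform d i 'X_[mon l] *m R).
have mevalK x m (M : 'M[k]_m) : map_mx (meval x) (map_mx (@mpolyC N k) M) = M.
  by apply/matrixP=> a b; rewrite !mxE mevalC.
have evalQ x : map_mx (meval x) Q = (\sum_(j < s) u j *m mulform d i (form_at x j)) *m R.
  rewrite mulmx_suml map_mx_sum; apply: eq_bigr => j _.
  rewrite mulform_form_at mulmx_sumr mulmx_suml map_mx_sum; apply: eq_bigr => l _.
  by rewrite -scalemxAr -scalemxAl map_mxZ mevalK.
exists (\det Q); [|move=> x]; rewrite -det_map_mx evalQ.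
  by rewrite -def_u VR det1 oner_neq0.
rewrite -unitfE -/(_ \in unitmx) => /mxrank_unit rk.
rewrite /hdim leq_sub2l // -/V -{1}rk (leq_trans (mxrankM_maxl _ _)) // mxrankS //.
by rewrite summx_sub_sums // => j _; rewrite genmxE submxMl.
Qed.

Lemma hdim_open_all s (b : nat -> nat) D :
    (forall i, (i < D)%N -> exists x, (hdim d (form_at x) s i <= b i)%N) ->
  exists p : {mpoly k[N]}, (exists x, p.@[x] != 0) /\
    forall x, p.@[x] != 0 -> forall i, (i < D)%N -> (hdim d (form_at x) s i <= b i)%N.
Proof.
elim: D => [|D IHD] att.
  by exists 1; split=> [|x]; [exists (fun=> 0); rewrite meval1 oner_neq0|].
have [i ltiD|p [[a pa] ph]] := IHD; first by apply: att; apply: ltnW.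
have [y by_y] := att D (ltnSn D); have [q qy qh] := hdim_open s D y.
exists (p * q); split; first exact: nonvanishing_mul pa qy.
move=> x; rewrite mevalM mulf_eq0 negb_or => /andP[px qx] i.
rewrite ltnS leq_eqVlt => /predU1P[->|/ph]; last exact.
exact: leq_trans (qh x qx) by_y.
Qed.
End Open.

Section Generic.
Variables (k : fieldType) (n d r R : nat) (G : nat -> {mpoly k[n]}).
Hypotheses (chark : [pchar k] =i pred0) (lerR : (r <= R)%N).
Hypothesis hG : forall j, G j \is d.-homog.

(* The first r forms are generic, the others are those of G. *)
Let coefs (j : nat) (l : 'I_(ndim n d)) : {mpoly k[r * ndim n d]} :=
  if insub j is Some j' then 'X_(mxvec_index (j' : 'I_r) l) else ((G j)@_(mon l))%:MP.

Let form_at_point (x : 'rV[k]_(r * ndim n d)) (j : 'I_r) :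
  form_at coefs (x 0) j = forms_of_point x j.
Proof.
rewrite /form_at /forms_of_point; apply: eq_bigr => l _.
by rewrite /coefs valK mevalXU mxE.
Qed.

Let form_at_base x (j : nat) : (r <= j)%N -> form_at coefs x j = G j.
Proof.
move=> lerj; rewrite [RHS](vpoly_eq_sum (hG j)); apply: eq_bigr => l _.
by rewrite /coefs insubF ?mevalC // ltnNge lerj.
Qed.

Let form_at_homog x (j : nat) : form_at coefs x j \is d.-homog.
Proof. by apply: rpred_sum => l _; rewrite rpredZ ?mpolyX_mon_homog. Qed.

Let eq_hdim (F F' : nat -> {mpoly k[n]}) s i :
  (forall j, (j < s)%N -> F j = F' j) -> hdim d F s i = hdim d F' s i.
Proof.
move=> eqF; rewrite /hdim /idl; congr (_ - \rank _)%N.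
by apply: eq_bigr => j _; rewrite eqF.
Qed.

(** The sample F may depend on the degree. Freezing the forms from r on at G lets r <= n generic
    forms be completed to n forms, where bounds are known. *)
Lemma generic_hdim (b : nat -> nat) D :
    (forall i, (i < D)%N -> exists F : nat -> {mpoly k[n]}, [/\ forall j, F j \is d.-homog,
       forall j, (r <= j < R)%N -> F j = G j & (hdim d F R i <= b i)%N]) ->
  @generic_forms k n d r (fun f => exists F : nat -> {mpoly k[n]}, [/\ forall j, F j \is d.-homog,
     forall j : 'I_r, f j = F j & forall i, (i < D)%N -> (hdim d F R i <= b i)%N]).
Proof.
move=> att; have [i ltiD|p [[x0 px0] ph]] := @hdim_open_all _ n d _ coefs chark R b D.
  have [F [hF FG leb]] := att i ltiD.
  pose c : 'M[k]_(r, ndim n d) := \matrix_(j, l) (F j)@_(mon l).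
  exists (mxvec c 0); rewrite (@eq_hdim _ F) // => j ltjR.
  have [ltjr|lerj] := ltnP j r; last by rewrite form_at_base // FG ?lerj.
  rewrite -[j]/(val (Ordinal ltjr)) form_at_point [RHS](vpoly_eq_sum (hF _)).
  by apply: eq_bigr => l _; rewrite mxvecK mxE.
exists (fun x => p.@[x 0] != 0); split.
- exists (fun q => q = p) => x; split=> [px | [_ -> //]]; by exists p.
- exists (\row_i x0 i); rewrite (@meval_eq _ _ _ x0) // => i; by rewrite mxE.
- move=> x px; exists (form_at coefs (x 0)); split=> [j|j|i].
  + exact: form_at_homog.
  + by rewrite form_at_point.
  + exact: ph.
Qed.
End Generic.

(** * Complete intersections *)

Lemma mxrank_sums_leq (k : fieldType) (I : Type) (r : seq I) (P : pred I) m (A : I -> 'M[k]_m) :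
  (\rank (\sum_(i <- r | P i) A i)%MS <= \sum_(i <- r | P i) \rank (A i))%N.
Proof.
elim/big_rec2: _ => [|i B b _ le]; first by rewrite mxrank0.
by apply: leq_trans (leq_add (leqnn _) le); have [] := mxrank_adds_leqif (A i) B.
Qed.

Section SpanBound.
Variables (k : fieldType) (n d : nat) (F : nat -> {mpoly k[n]}) (s i : nat).
Hypothesis hF : forall j, F j \is d.-homog.
Let inI := in_ideal (fun j : 'I_s => F j).

(** The [T b l] span degree i modulo the ideal. The rows of [M b] are relations among those of block
    b, so a complement of its row space, of dimension [t b - \rank (M b)], suffices to span the
    block. *)
Lemma hdim_le_blocks (B : finType) (t a : B -> nat)
    (T : forall b, 'I_(t b) -> {mpoly k[n]}) (M : forall b, 'M[k]_(a b, t b)) :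
    (forall b u, inI (\sum_l M b u l *: T b l)) ->
    (forall m, mdeg m = i -> inI 'X_[m] \/ exists b l, inI ('X_[m] - T b l)) ->
  (hdim d F s i <= \sum_b (t b - \rank (M b)))%N.
Proof.
move=> MT cover; set V := idl d F s i.
pose E b : 'M_(t b, ndim n i) := \matrix_l cvec i (T b l).
have EV b : (E b <= V + (M b)^C *m E b)%MS.
  have sub1 : (1%:M *m E b <= (M b + (M b)^C)%MS *m E b)%MS.
    by rewrite submxMr // submx_full ?addsmx_compl_full.
  rewrite -{1}[E b]mul1mx; apply: submx_trans sub1 _.
  rewrite addsmxMr addsmxS //; apply/row_subP => u.
  have -> : row u (M b *m E b) = cvec i (\sum_l M b u l *: T b l).
    rewrite row_mul mulmx_sum_row linear_sum; apply: eq_bigr => l _.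
    by rewrite rowK linearZ mxE.
  exact: cvec_in_idl hF (MT b u).
have full : (1%:M <= V + \sum_b <<((M b)^C *m E b)%R>>)%MS.
  apply/row_subP=> l; rewrite -[row l _]vpolyK.
  have -> : vpoly (row l 1%:M) = 'X_[@mon n i l] :> {mpoly k[n]}.
    rewrite /vpoly (bigD1 l) //= big1 ?addr0 => [|l' ne]; rewrite !mxE ?eqxx ?scale1r //.
    by rewrite eq_sym (negPf ne) scale0r.
  have [inIl|[b [u inIl]]] := cover (mon l) (mdeg_mon l).
    by apply: submx_trans (addsmxSl _ _); apply: cvec_in_idl hF inIl.
  rewrite -['X_[_]](subrK (T b u)) linearD addmx_sub //=.
    by apply: submx_trans (addsmxSl _ _); apply: cvec_in_idl hF inIl.
  apply: (@submx_trans _ _ _ _ _ _ (E b)).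
    by rewrite -[cvec _ _](rowK (fun u => cvec i (T b u))) row_sub.
  apply: submx_trans (EV b) _; rewrite addsmxS //.
  by rewrite (sumsmx_sup b) // genmxE.
move/mxrankS: full; rewrite mxrank1 => full.
have [le1 _] := mxrank_adds_leqif V (\sum_b <<((M b)^C *m E b)%R>>)%MS.
have le2 := mxrank_sums_leq (index_enum B) xpredT (fun b => <<((M b)^C%MS *m E b)%R>>%MS).
have le3 : (\sum_b \rank <<((M b)^C%MS *m E b)%R>>%MS <= \sum_b (t b - \rank (M b)))%N.
  by apply: leq_sum => b _; rewrite genmxE -mxrank_compl mxrankM_maxl.
rewrite /hdim -/V leq_subLR; apply: leq_trans full (leq_trans le1 _).
by rewrite leq_add2l (leq_trans le2 le3).
Qed.
End SpanBound.

Section Powers.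
Variables (k : fieldType) (n d : nat).
Hypotheses (n0 : (0 < n)%N) (d0 : (0 < d)%N).

Definition powers (j : nat) : {mpoly k[n]} :=
  if insub j is Some v then 'X_(v : 'I_n) ^+ d else 0.

Lemma powers_homog j : powers j \is d.-homog.
Proof.
rewrite /powers; case: insubP => [v _ _|_]; last exact: dhomog0.
by rewrite mpolyXn dhomogX /= mdegMn mdeg1 mul1n.
Qed.

Definition reduced (s : nat) (m : 'X_{1..n}) : bool :=
  [forall v : 'I_n, (v < s)%N ==> (m v < d)%N].

Lemma reducedS (v : 'I_n) m : reduced v.+1 m = reduced v m && (m v < d)%N.
Proof.
apply/forallP/andP => [red|[/forallP red mv] w].
  split; last by have:= red v; rewrite ltnSn.
  by apply/forallP => w; apply/implyP=> ltwv; have /implyP-> := red w; rewrite // ltnW.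
by apply/implyP; rewrite ltnS leq_eqVlt => /predU1P[/val_inj->//|]; apply/implyP/red.
Qed.

(** The condition [reduced v] does not constrain the exponent of v itself, so division by the d-th
    power of that variable is a bijection from the monomials that fail the new condition to those of
    degree i - d. This is the recursion of [hcoefS]. *)
Lemma count_reducedS (v : 'I_n) i :
  (count (reduced v) (monomials n i) = count (reduced v.+1) (monomials n i) +
     (if d <= i then count (reduced v) (monomials n (i - d)) else 0))%N.
Proof.
rewrite -size_filter -(count_predC (fun m : 'X_{1..n} => (m v < d)%N)) !count_filter.
congr (_ + _)%N; first by apply: eq_count => m /=; rewrite reducedS andbC.
have [ledi|ltid] := leqP d i; last first.
  apply/eqP; rewrite -leqn0 leqNgt -has_count; apply/hasPn=> m.
  rewrite mem_monomials /= => /eqP dm; rewrite -leqNgt negb_and -ltnNge.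
  by rewrite (leq_ltn_trans _ ltid) // -dm mdegE (bigD1 v) //= leq_addr.
rewrite -!size_filter -[RHS](size_map (fun m => m + U_(v) *+ d)%MM); apply/perm_size/uniq_perm.
- by rewrite filter_uniq ?uniq_monomials.
- rewrite map_inj_uniq ?filter_uniq ?uniq_monomials // => m m'.
  by move/(congr1 (fun m => m - U_(v) *+ d)%MM); rewrite !addmK.
move=> m; rewrite mem_filter mem_monomials /= -leqNgt.
have redE m' : reduced v (m' + U_(v) *+ d)%MM = reduced v m'.
  apply: eq_forallb => w; rewrite mnmDE mulmnE mnm1E.
  by have [<-|] := eqVneq v w; rewrite ?ltnn // addn0.
apply/andP/mapP => [[/andP[ledm red] /eqP dm]|[m' + ->]].
  have def_m : m = (m - U_(v) *+ d + U_(v) *+ d)%MM.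
    rewrite submK //; apply/mnm_lepP => w; rewrite mulmnE mnm1E.
    by have [<-|] := eqVneq v w; rewrite ?mul1n.
  exists (m - U_(v) *+ d)%MM => //; rewrite mem_filter mem_monomials -redE -def_m red /=.
  have := congr1 mdeg def_m; rewrite dm mdegD mdegMn mdeg1 mul1n => ->.
  by rewrite addnK.
rewrite mem_filter mem_monomials redE mdegD mdegMn mdeg1 mul1n => /andP[-> /eqP ->].
by rewrite subnK // eqxx mnmDE mulmnE mnm1E eqxx mul1n leq_addl.
Qed.

Lemma count_reducedE s i : (s <= n)%N ->
  (count (reduced s) (monomials n i))%:R = hcoef n d s i.
Proof.
elim: s i => [|s IHs] i lesn.
  rewrite hcoef0_ndim // -[ndim n i]/(ndim n i) /ndim -size_monomials; congr (_%:R).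
  by apply/eqP; rewrite -all_count; apply/allP=> m _; apply/forallP.
have := count_reducedS (Ordinal lesn) i; rewrite hcoefS /= => red_i.
rewrite -!(IHs _ (ltnW lesn)) red_i natrD.
by case: (d <= i)%N; rewrite ?addrK // mulr0n subr0 addr0.
Qed.

Lemma hdim_powers_leq s i : (s <= n)%N -> (hdim d powers s i)%:R <= hcoef n d s i.
Proof.
move=> lesn; rewrite -count_reducedE // ler_nat -size_filter.
set T := filter _ _.
apply: leq_trans (@hdim_le_blocks _ _ _ _ _ _ powers_homog 'I_1 (fun=> size T) (fun=> 0%N)
  (fun _ l => 'X_[nth 0%MM T l]) (fun=> 0) _ _) _.
- by move=> b [].
- move=> m dm; have [red|] := boolP (reduced s m).
    have mT : m \in T by rewrite mem_filter red mem_monomials dm eqxx.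
    right; exists ord0, (Ordinal (etrans (index_mem m T) mT)).
    by rewrite nth_index // subrr; exact: in_ideal0.
  rewrite negb_forall => /existsP[v]; rewrite negb_imply -leqNgt => /andP[ltvs ledm].
  have le_m : (U_(v) *+ d <= m)%MM.
    apply/mnm_lepP => w; rewrite mulmnE mnm1E.
    by have [<-|] := eqVneq v w; rewrite ?mul1n.
  left; rewrite -(submK le_m).
  rewrite mpolyXD -mpolyXn; apply: in_idealM.
  have -> : 'X_v ^+ d = powers (Ordinal ltvs) by rewrite /powers valK.
  exact: (@in_ideal_gen _ _ _ (fun j : 'I_s => powers j)).
by rewrite big_ord1 leq_subr.
Qed.

(** A monomial with all n exponents below d has degree at most n (d - 1). *)
Lemma hcoef_reduced_eq0 i : (n * d.-1 < i)%N -> hcoef n d n i = 0.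
Proof.
move=> lt_i; rewrite -count_reducedE // (_ : count _ _ = 0%N) //.
apply/eqP; rewrite -leqn0 leqNgt -has_count; apply/hasPn=> m.
rewrite mem_monomials => /eqP dm; apply/negP => /forallP red.
move: lt_i; rewrite ltnNge -dm mdegE; case/negP.
have <- : (\sum_(v < n) d.-1 = n * d.-1)%N by rewrite sum_nat_const card_ord.
apply: leq_sum => v _.
by have /implyP/(_ (ltn_ord v)) := red v; lia.
Qed.
End Powers.

(** * From sample points to generic forms *)

Section Table.
Variables (k : fieldType) (n d : nat).
Hypotheses (chark : [pchar k] =i pred0) (n0 : (0 < n)%N) (d0 : (0 < d)%N).

Definition froberg (r : nat) : Prop := @generic_forms k n d r (fun f : 'I_r -> {mpoly k[n]} =>
    is_hilbert_series (in_ideal f) (bracket (hcoef n d r))).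

Definition attains (r i : nat) (z : int) : Prop :=
  exists F : nat -> {mpoly k[n]}, (forall j, F j \is d.-homog) /\ (hdim d F r i)%:R <= z.

Lemma eq_in_ideal r (f g : 'I_r -> {mpoly k[n]}) p :
  (forall j, f j = g j) -> in_ideal f p -> in_ideal g p.
Proof. by move=> eqfg [h ->]; exists h; apply: eq_bigr => j _; rewrite eqfg. Qed.

(** The last two hypotheses treat the degrees before the first non-positive coefficient and that
    degree itself; beyond it [hdim_eq0_leq] applies. *)
Lemma hilbert_series_bracket (F : nat -> {mpoly k[n]}) r (f : 'I_r -> {mpoly k[n]}) :
    (forall j, F j \is d.-homog) -> (forall j : 'I_r, f j = F j) ->
    (forall i, (forall j, (j <= i)%N -> 0 < hcoef n d r j) -> (hdim d F r i)%:R = hcoef n d r i) ->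
    (forall i, (forall j, (j < i)%N -> 0 < hcoef n d r j) -> hcoef n d r i <= 0 ->
       hdim d F r i = 0%N) ->
  is_hilbert_series (in_ideal f) (bracket (hcoef n d r)).
Proof.
move=> hF eqfF hpos hneg i; exists (hdim d F r i).
  have [b [hb gen_b free_b]] := quotient_dim_hdim r i hF; exists b; split=> // [p hp|c].
    have [c Ic] := gen_b p hp; exists c; apply: eq_in_ideal Ic => j; exact/esym/eqfF.
  by move/(@eq_in_ideal _ _ (fun j => F j) _ eqfF); apply: free_b.
rewrite /bracket; case: forallP => [pos | /forallP].
  by rewrite -hpos ?natz // => j leji; apply: (pos (Ordinal (leji : (j < i.+1)%N))).
rewrite negb_forall => /existsP[j0]; rewrite -leNgt => j0le.
have ex_j : exists j, hcoef n d r j <= 0 by exists (j0 : nat).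
case: (ex_minnP ex_j) => j jle jmin.
suff -> : hdim d F r i = 0%N by [].
apply: (@hdim_eq0_leq _ _ _ _ _ j) => //.
  by apply: leq_trans (jmin _ j0le) _; rewrite -ltnS.
apply: hneg => // j' ltj'; rewrite ltNge; apply/negP => /jmin.
by rewrite leqNgt ltj'.
Qed.

Lemma froberg_small r : (r <= n)%N -> froberg r.
Proof.
(* The last degree below D, n (d - 1) + 1, is the first one without reduced monomials; vanishing
   there settles all higher degrees. *)
move=> lern; pose D := (n * d.-1).+2.
have [i _|U [openU exU PU]] := @generic_hdim k n d r n (powers k n d) chark (@powers_homog k n d)
   (fun i => `|hcoef n d n i|%N) D.
  exists (powers k n d); split=> //; first exact: powers_homog.
  have := @hdim_powers_leq k n d n0 n i (leqnn n); lia.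
exists U; split=> // x /PU[F [hF eqF leF]].
have hD : hdim d F n D.-1 = 0%N.
  by apply/eqP; rewrite -leqn0; apply: leq_trans (leF D.-1 (ltnSn _)) _; rewrite hcoef_reduced_eq0.
have ub i : (hdim d F n i)%:R <= hcoef n d n i.
  have [ltiD|leDi] := ltnP i D.
    have := leF i ltiD; rewrite -count_reducedE //; lia.
  by rewrite (hdim_eq0_leq hF _ hD) ?hcoef_reduced_eq0 // (leq_trans _ leDi) ?leq_pred.
have exact i : (hdim d F r i)%:R = hcoef n d r i.
  by apply: (@hdim_exact _ _ _ F n0 d0 hF n i) => // j _; apply: ub.
apply: (hilbert_series_bracket hF eqF) => // i _.
by rewrite -exact; lia.
Qed.

(** The samples of the different degrees are replaced by one generic family, to which [hdim_exact]
    applies. *)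
Lemma attains_exact R D : (forall i, (i < D)%N -> attains R i (hcoef n d R i)) ->
  forall r i, (r <= R)%N -> (i < D)%N -> attains r i (hcoef n d r i).
Proof.
move=> att r i lerR ltiD.
have [j ltjD|U [_ [x Ux] PU]] := @generic_hdim k n d R R (fun=> 0) chark (fun=> dhomog0 _ _ _)
   (fun i => `|hcoef n d R i|%N) D.
  have [F [hF leF]] := att j ltjD; exists F; split=> // [j'|]; last by move: leF; lia.
  by case: ltnP => //; rewrite ?andbF // andbT.
have [F [hF _ leF]] := PU x Ux; exists F; split=> //.
rewrite (@hdim_exact _ _ _ F n0 d0 hF R D.-1) //; last by lia.
move=> j lejD; have ltjD : (j < D)%N by lia.
have [F' [_ leF']] := att j ltjD; have := leF j ltjD; lia.
Qed.

Lemma froberg_large r D :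
    (forall i, (i < D)%N -> attains r i (hcoef n d r i)) -> attains r D 0 -> froberg r.
Proof.
move=> att att0; pose b i := if (i < D)%N then `|hcoef n d r i|%N else 0%N.
have [i|U [openU exU PU]] := @generic_hdim k n d r r (fun=> 0) chark (fun=> dhomog0 _ _ _) b D.+1.
  rewrite ltnS leq_eqVlt /b => /predU1P[-> | ltiD].
    have [F [hF leF]] := att0; exists F; split=> // [j|]; last by rewrite ltnn; move: leF; lia.
    by case: ltnP => //; rewrite ?andbF // andbT.
  have [F [hF leF]] := att i ltiD; exists F; split=> // [j|]; last by rewrite ltiD; move: leF; lia.
  by case: ltnP => //; rewrite ?andbF // andbT.
exists U; split=> // x /PU[F [hF eqF leF]].
have exact i s : (i < D)%N -> (s <= r)%N -> (hdim d F s i)%:R = hcoef n d s i.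
  move=> ltiD; apply: (@hdim_exact _ _ _ F n0 d0 hF r D.-1); last by lia.
  move=> j lejD; have ltjD : (j < D)%N by lia.
  have [F' [_ leF']] := att j ltjD; have := leF j (ltnW ltjD); rewrite /b ltjD; lia.
have hD : hdim d F r D = 0%N.
  by apply/eqP; rewrite -leqn0; have := leF D (ltnSn D); rewrite /b ltnn.
(* So the first non-positive coefficient occurs in degree D at the latest; if earlier, it equals a
   dimension and is therefore 0. *)
have hcD : hcoef n d r D <= 0.
  by have := @hdim_geq _ _ _ F n0 d0 hF r D exact r (leqnn r); rewrite hD.
apply: (hilbert_series_bracket hF eqF) => i pos.
  apply: exact => //; rewrite ltnNge; apply/negP => /pos.
  by rewrite ltNge hcD.
have [ltiD|] := ltnP i D; first by rewrite -exact //; lia.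
rewrite leq_eqVlt => /predU1P[<- //|/pos]; by rewrite ltNge hcD.
Qed.

Lemma attains_leq r s i z : (r <= s)%N -> attains r i z -> attains s i z.
Proof.
move=> lers [F [hF leF]]; exists F; split=> //; apply: le_trans leF.
by rewrite ler_nat hdim_leq_r.
Qed.

Lemma froberg_table (R S : nat -> nat) D : (d <= D)%N ->
    (forall i, (d <= i < D)%N -> attains (R i) i (hcoef n d (R i) i)) ->
    (forall i j, (d <= i <= j)%N -> (j < D)%N -> (R j <= R i)%N) ->
    (forall i, (d <= i <= D)%N -> attains (S i) i 0) ->
    (forall i, (d <= i < D)%N -> (S i <= (R i).+1)%N) -> (S D <= n.+1)%N ->
  forall r, froberg r.
Proof.
move=> ledD inj mono surj leSR leSn r.
have [|ltnr] := leqP r n; first exact: froberg_small.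
(* [attains_exact] with [R i] forms needs samples in all degrees up to i; in lower degrees they come
   from the induction, since R decreases. *)
have att : forall i, (i < D)%N ->
    forall s, ((d <= i)%N -> (s <= R i)%N) -> attains s i (hcoef n d s i).
  elim/ltn_ind=> i IHi ltiD s leR.
  have [ltid|ledi] := ltnP i d.
    exists (fun=> 0); split=> [j|]; first exact: dhomog0.
    rewrite hdim_lt ?hcoef_lt // => j; exact: dhomog0.
  apply: (@attains_exact (R i) i.+1) => // [j|]; last exact: leR.
  rewrite ltnS leq_eqVlt => /predU1P[->|ltji]; first by apply: inj; rewrite ledi.
  apply: IHi => // [|ledj]; first exact: ltn_trans ltiD.
  by apply: mono; rewrite ?ledj //= ltnW.
have ex_i : exists i, (d <= i <= D)%N && ((i == D) || (R i < r)%N).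
  by exists D; rewrite ledD leqnn eqxx.
(* This i is a degree where r forms leave nothing, while r <= R j in every degree j from d up to i -
   1. *)
case: (ex_minnP ex_i) => i /andP[/andP[ledi leiD] iP] imin.
apply: (@froberg_large r i) => [j ltji|].
  apply: att => [|ledj]; first exact: leq_trans leiD.
  have ltjD : (j < D)%N by apply: leq_trans leiD.
  rewrite leqNgt; apply/negP => ltRr; have := imin j.
  by rewrite ledj ltRr orbT ltnW //= leqNgt ltji => /(_ isT).
apply: (@attains_leq (S i)); last by apply: surj; rewrite ledi.
case/predU1P: iP => [->|ltRr]; first exact: leq_trans ltnr.
have [eqiD|neiD] := eqVneq i D; first by rewrite eqiD (leq_trans leSn).
by apply: leq_trans ltRr; apply: leSR; rewrite ledi ltn_neqAle neiD.
Qed.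
End Table.

(** * Rank of a bit matrix *)

Lemma natr_neq0_pchar0 (k : fieldType) (z : int) :
  [pchar k] =i pred0 -> (z%:~R == 0 :> k) = (z == 0).
Proof.
move/pcharf0P => natk; case: z => j; first exact: natk.
by rewrite NegzE mulrNz oppr_eq0 natk.
Qed.

(** Matrices Q and R over F_2 with Q M R = 1 of size the rank are lifted to integers. The
    determinant of the lifted product is odd, hence nonzero in characteristic 0. *)
Lemma mxrank_mod2 (k : fieldType) m n (M : 'M[int]_(m, n)) : [pchar k] =i pred0 ->
  (\rank (map_mx intr M : 'M['F_2]_(m, n)) <= \rank (map_mx intr M : 'M[k]_(m, n)))%N.
Proof.
move=> chark; set A := (X in (\rank X <= _)%N).
have /row_freeP[R AR] := row_base_free A.
have /submxP[Q def_Q] : (row_base A <= A)%MS by rewrite eq_row_base.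
pose lift p q (X : 'M['F_2]_(p, q)) : 'M[int]_(p, q) := map_mx (fun x : 'F_2 => (x : nat)%:Z) X.
have liftK p q (X : 'M['F_2]_(p, q)) : map_mx intr (lift p q X) = X.
  apply/matrixP=> i j; rewrite !mxE; exact: natr_Zp.
pose D := lift _ _ Q *m M *m lift _ _ R.
have D1 : map_mx intr D = 1%:M :> 'M['F_2]_(\rank A).
  by rewrite !map_mxM !liftK -def_Q.
have detD : \det D != 0.
  apply/eqP => D0; have := det_map_mx (intr : int -> 'F_2) D.
  by rewrite D1 det1 D0 rmorph0 => /eqP; rewrite oner_eq0.
have : map_mx intr D \in (unitmx : {pred 'M[k]_(\rank A)}).
  by rewrite unitmxE det_map_mx unitfE natr_neq0_pchar0.
move/mxrank_unit <-; rewrite !map_mxM.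
exact: leq_trans (mxrankM_maxl _ _) (mxrankM_maxr _ _).
Qed.

(* Rows of bits; RZ stands for an infinite row of zeros. *)
Inductive brow := RZ | R0 of brow | R1 of brow.

Fixpoint xrow (a b : brow) : brow :=
  match a, b with
  | RZ, _ => b | _, RZ => a
  | R0 a, R0 b => R0 (xrow a b) | R0 a, R1 b => R1 (xrow a b)
  | R1 a, R0 b => R1 (xrow a b) | R1 a, R1 b => R0 (xrow a b)
  end.

(** Entry j of ps is the pivot row with leading column j, stored without its leading one and what
    precedes it. The result is [None] when the row reduces to zero. *)
Fixpoint insert (r : brow) (ps : seq (option brow)) : option (seq (option brow)) :=
  match ps with
  | [::] => None
  | p :: ps' =>
    match r with
    | RZ => None
    | R0 r' => match insert r' ps' with None => None | Some qs => Some (p :: qs) end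
    | R1 r' => match p with
               | None => Some (Some r' :: ps')
               | Some q => match insert (xrow q r') ps' with
                           | None => None | Some qs => Some (p :: qs) end
               end
    end
  end.

(* Inserts the rows rs into the echelon form ps, which lacks c pivots, and      *)
(* stops as soon as none is missing.                                           *)
Fixpoint corank (c : nat) (ps : seq (option brow)) (rs : seq brow) : nat :=
  match c with
  | 0 => 0
  | c'.+1 => match rs with
             | [::] => c
             | r :: rs' => match insert r ps with
                           | None => corank c ps rs'
                           | Some ps' => corank c' ps' rs'
                           end
             end
  end%N.

Fixpoint bits (r : brow) : seq bool :=
  match r with RZ => [::] | R0 r' => false :: bits r' | R1 r' => true :: bits r' end.

Section Elimination.
Variable n : nat.

(** The offset o counts the columns already passed, so that the tail of a row keeps its position. *)
Definition bitvec (o : nat) (r : brow) : 'rV['F_2]_n :=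
  \row_l ((o <= l)%N && nth false (bits r) (l - o))%:R.

Lemma nth_xrow a b l :
  nth false (bits (xrow a b)) l = nth false (bits a) l (+) nth false (bits b) l.
Proof.
elim: a b l => [|a IHa|a IHa] [|b|b] [|l] //=; rewrite ?nth_nil ?addbF ?IHa //.
Qed.

Lemma F2_addb (b c : bool) : (b (+) c)%:R = b%:R + c%:R :> 'F_2.
Proof. by case: b c => [] []; apply: val_inj. Qed.

Lemma bitvec_xrow o a b : bitvec o (xrow a b) = bitvec o a + bitvec o b.
Proof.
apply/rowP=> l; rewrite !mxE -F2_addb nth_xrow.
by case: (o <= l)%N.
Qed.

Lemma bitvec_R0 o r : bitvec o (R0 r) = bitvec o.+1 r.
Proof.
apply/rowP=> l; rewrite !mxE; case: ltngtP => //= [ltol|->]; last by rewrite subnn.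
by rewrite subnS -(@prednK (l - o)) ?subn_gt0.
Qed.

Lemma bitvec_R1_xrow o q r :
  bitvec o.+1 (xrow q r) = bitvec o (R1 q) + bitvec o (R1 r).
Proof. by rewrite -bitvec_R0 -bitvec_xrow. Qed.

Variables (a : nat) (A : 'M['F_2]_(a, n)).

Fixpoint valid (o : nat) (ps : seq (option brow)) : Prop :=
  if ps is p :: ps' then
    (if p is Some q then (bitvec o (R1 q) <= A)%MS else True) /\ valid o.+1 ps'
  else True.

Lemma valid_nseq o m : valid o (nseq m None).
Proof. by elim: m o => //= m IHm o. Qed.

Definition npivots (ps : seq (option brow)) : nat := count isSome ps.

Lemma insert_valid o r ps ps' : valid o ps -> (bitvec o r <= A)%MS -> insert r ps = Some ps' ->
  [/\ valid o ps', npivots ps' = (npivots ps).+1 & size ps' = size ps].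
Proof.
elim: ps o r ps' => [|p ps IHps] o r ps' //= [vp vps].
case: r => [|r|r] //= rA.
  case: insert (IHps o.+1 r) => // qs IH [<-] /=.
  by have [|||v -> ->] := IH qs; rewrite -?bitvec_R0 // /npivots /= addnS.
case: p vp => [q qA | _ [<-] //].
case: insert (IHps o.+1 (xrow q r)) => // qs IH [<-] /=.
by have [|||v -> ->] := IH qs; rewrite ?bitvec_R1_xrow ?addmx_sub // /npivots /= addnS.
Qed.

(** Rows with distinct leading columns are independent: the pivot rows further right span a space B
    that vanishes in column o, where the new pivot row has a one. *)
Lemma npivots_rank o ps : (o + size ps <= n)%N -> valid o ps -> (npivots ps <= \rank A)%N.
Proof.
move=> leon vps.
suff [B [BA <- _]] : exists B : 'M_n, [/\ (B <= A)%MS, \rank B = npivots ps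
    & forall w : 'rV_n, (w <= B)%MS -> forall l : 'I_n, (l < o)%N -> w 0 l = 0] by apply: mxrankS.
elim: ps o leon vps => [|p ps IHps] o /= leon.
  exists 0; split; rewrite ?sub0mx ?mxrank0 // => w.
  by rewrite submx0 => /eqP-> l _; rewrite mxE.
case=> vp /IHps[|B [BA rkB B0]]; first by rewrite addSnnS.
case: p vp => [q qA|_]; last by exists B; split=> // w wB l ltlo; apply: (B0 w wB); apply: ltnW.
pose v := bitvec o (R1 q); have lton : (o < n)%N by lia.
exists (B + v)%MS; split; first by rewrite addsmx_sub BA.
  apply/eqP; rewrite eqn_leq /npivots /= add1n -/(npivots ps) -rkB; apply/andP; split.
    have [le _] := mxrank_adds_leqif B v; apply: leq_trans le _.
    by rewrite -[X in (_ <= X)%N]addn1 leq_add2l rank_leq_row.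
  rewrite rank_ltmx // ltmxE addsmxSl addsmx_sub submx_refl /=.
  apply/negP => /B0/(_ (Ordinal lton) (ltnSn o)).
  by rewrite mxE leqnn subnn /= => /eqP; rewrite oner_eq0.
move=> w /sub_addsmxP[[u1 u2] ->] l ltlo /=.
have w1 := B0 _ (submxMl u1 B) l (ltnW ltlo).
have w2 : (u2 *m v) 0 l = 0 by rewrite mxE big_ord1 mxE leqNgt ltlo mulr0.
by rewrite mxE w1 w2 addr0.
Qed.

Lemma corank_leq c ps rs : (size ps <= n)%N -> valid 0 ps -> (c + npivots ps = n)%N ->
    (forall j, (j < size rs)%N -> (bitvec 0 (nth RZ rs j) <= A)%MS) ->
  (n - \rank A <= corank c ps rs)%N.
Proof.
elim: rs c ps => [|r rs IHrs] [|c] ps leps vps eqn_c rsA /=;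
  have := @npivots_rank 0 ps leps vps; try lia.
move=> _; have rA := rsA 0%N isT; have {}rsA j : (j < size rs)%N -> _ := rsA j.+1.
case ins_r: insert => [ps'|]; last exact: IHrs.
have [vps' np' sz'] := insert_valid vps rA ins_r.
by apply: IHrs; rewrite ?sz' ?np' ?addnS.
Qed.
End Elimination.

(** * Monomials of the sample algebras *)

(* Bits indexed by sequences of digits 0, 1, 2, 3. *)
Inductive trie := TE | TL of bool | TN of trie & trie & trie & trie.

Fixpoint toggle (p : seq nat) (t : trie) : trie :=
  match p, t with
  | [::], TL b => TL (if b then false else true)
  | c :: p', TN t0 t1 t2 t3 =>
    match c with
    | 0 => TN (toggle p' t0) t1 t2 t3
    | 1 => TN t0 (toggle p' t1) t2 t3
    | 2 => TN t0 t1 (toggle p' t2) t3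
    | 3 => TN t0 t1 t2 (toggle p' t3)
    | _ => t
    end
  | _, _ => t
  end%N.

Fixpoint tget (p : seq nat) (t : trie) : option bool :=
  match p, t with
  | [::], TL b => Some b
  | c :: p', TN t0 t1 t2 t3 =>
    match c with
    | 0 => tget p' t0 | 1 => tget p' t1 | 2 => tget p' t2 | 3 => tget p' t3 | _ => None
    end
  | _, _ => None
  end%N.

Fixpoint paths (t : trie) : seq (seq nat) :=
  match t with
  | TE => [::]
  | TL _ => [:: [::]]
  | TN t0 t1 t2 t3 => map (cons 0%N) (paths t0) ++ map (cons 1%N) (paths t1)
      ++ map (cons 2%N) (paths t2) ++ map (cons 3%N) (paths t3)
  end.

(** The accumulator r holds the bits of the leaves further right; columns come in the order of
    [paths]. *)
Fixpoint row_of (t : trie) (r : brow) : brow :=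
  match t with
  | TE => r
  | TL b => if b then R1 r else R0 r
  | TN t0 t1 t2 t3 => row_of t0 (row_of t1 (row_of t2 (row_of t3 r)))
  end.

Lemma mem_map_cons (T : eqType) (c c' : T) (p : seq T) (s : seq (seq T)) :
  (c :: p \in map (cons c') s) = (c == c') && (p \in s).
Proof.
apply/mapP/andP => [[q qs [-> ->]] // | [/eqP -> ps]]; by exists p.
Qed.

Lemma mem_paths p t : (p \in paths t) = (tget p t : bool).
Proof.
elim: t p => [|b|t0 IH0 t1 IH1 t2 IH2 t3 IH3] [|c p] //=; rewrite !mem_cat.
  by do 4![rewrite (_ : ([::] \in map (cons _) _) = false); last by apply/negP => /mapP[]].
rewrite !mem_map_cons IH0 IH1 IH2 IH3.
by case: c => [|[|[|[|c]]]] /=; rewrite ?orbF ?andbF.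
Qed.

Lemma uniq_paths t : uniq (paths t).
Proof.
have inj_cons (c : nat) : injective (cons c) by move=> ? ? [].
have disj (c c' : nat) s s' : c != c' -> has [in map (cons c) s] (map (cons c') s') = false.
  move=> ne; apply/hasPn => _ /mapP[q _ ->] /=; rewrite mem_map_cons.
  by rewrite eq_sym (negPf ne).
elim: t => //= t0 IH0 t1 IH1 t2 IH2 t3 IH3.
by rewrite !cat_uniq !has_cat !map_inj_uniq // !disj // IH0 IH1 IH2 IH3.
Qed.

Lemma paths_toggle p t : paths (toggle p t) = paths t.
Proof.
elim: t p => [|b|t0 IH0 t1 IH1 t2 IH2 t3 IH3] [|c p] //.
by case: c => [|[|[|[|c]]]] /=; rewrite ?IH0 ?IH1 ?IH2 ?IH3.
Qed.

Lemma tget_toggle p q t b : tget p t = Some b ->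
  tget q (toggle p t) = if q == p then Some (~~ b) else tget q t.
Proof.
elim: t p q b => [|b0|t0 IH0 t1 IH1 t2 IH2 t3 IH3] [|c p] [|c' q] b //.
- by case=> <-; case: b0.
- by case: c => [|[|[|[|c]]]].
case: c => [|[|[|[|c]]]] //= get_p; case: c' => [|[|[|[|c']]]] //=;
  by rewrite eqseq_cons /= ?(IH0 p q b) ?(IH1 p q b) ?(IH2 p q b) ?(IH3 p q b).
Qed.

Lemma bits_row_of t r : bits (row_of t r) = [seq odflt false (tget p t) | p <- paths t] ++ bits r.
Proof.
elim: t r => [|[]|t0 IH0 t1 IH1 t2 IH2 t3 IH3] r //=.
by rewrite IH0 IH1 IH2 IH3 !map_cat -!map_comp -!catA.
Qed.

(* Tensor factors of the quotient by the first n forms: k[x, y]/(xy, x^2 - y^2) *)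
(* with basis 1, x, y, x^2, whose elements have codes 0, 1, 2, 3; k[x]/(x^2)    *)
(* and k[x]/(x^3) with x^c coded by c. A basis element of the quotient is a     *)
(* sequence of codes, and None stands for a product that is zero.               *)
Inductive kind := Pair | Square | Cube.

Definition code_deg kd (c : nat) : option nat :=
  match kd with
  | Pair => match c with 0 => Some 0 | 1 => Some 1 | 2 => Some 1 | 3 => Some 2 | _ => None end
  | Square => match c with 0 => Some 0 | 1 => Some 1 | _ => None end
  | Cube => match c with 0 => Some 0 | 1 => Some 1 | 2 => Some 2 | _ => None end
  end%N.

Definition code_mul kd (a b : nat) : option nat :=
  match kd with
  | Pair => match a, b with
            | 0, _ => Some b | _, 0 => Some a | 1, 1 => Some 3 | 2, 2 => Some 3 | _, _ => None end
  | Square => match a, b with 0, _ => Some b | _, 0 => Some a | _, _ => None end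
  | Cube => match a, b with 0, _ => Some b | _, 0 => Some a | 1, 1 => Some 2 | _, _ => None end
  end%N.

Fixpoint codes_mul (L : seq kind) (p q : seq nat) : option (seq nat) :=
  match L with
  | [::] => Some [::]
  | kd :: L' =>
    match p, q with
    | a :: p', b :: q' =>
      match code_mul kd a b with
      | None => None
      | Some c => match codes_mul L' p' q' with None => None | Some r => Some (c :: r) end
      end
    | _, _ => None
    end
  end.

Fixpoint codes_deg (L : seq kind) (p : seq nat) : option nat :=
  match L, p with
  | [::], [::] => Some 0
  | kd :: L', c :: p' =>
    match code_deg kd c, codes_deg L' p' with Some a, Some b => Some (a + b) | _, _ => None end
  | _, _ => None
  end%N.

Definition nvars kd : nat := if kd is Pair then 2 else 1.

Definition code_of kd (e : nat -> nat) v : option nat :=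
  match kd with
  | Pair => match e v, e v.+1 with
            | 0, 0 => Some 0 | 1, 0 => Some 1 | 0, 1 => Some 2
            | 2, 0 => Some 3 | 0, 2 => Some 3 | _, _ => None end
  | Square => match e v with 0 => Some 0 | 1 => Some 1 | _ => None end
  | Cube => match e v with 0 => Some 0 | 1 => Some 1 | 2 => Some 2 | _ => None end
  end%N.

Fixpoint codes_of (L : seq kind) (e : nat -> nat) v : option (seq nat) :=
  match L with
  | [::] => Some [::]
  | kd :: L' => match code_of kd e v, codes_of L' e (v + nvars kd) with
                | Some c, Some p => Some (c :: p) | _, _ => None end
  end.

Definition nvars_all (L : seq kind) : nat := sumn (map nvars L).

Lemma codes_of_deg L e v p : codes_of L e v = Some p ->
  codes_deg L p = Some (\sum_(v <= u < v + nvars_all L) e u)%N.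
Proof.
elim: L v p => [|kd L IHL] v p /=; first by case=> <-; rewrite /nvars_all /= addn0 big_geq.
case def_c: (code_of kd e v) => [c|//]; case def_p: codes_of => [p'|//] [<-] /=.
rewrite (IHL _ _ def_p) /nvars_all /= addnA.
rewrite [in RHS](big_cat_nat (n := (v + nvars kd)%N)) ?leq_addr //=.
set S := (X in (_ + X)%N).
have -> : code_deg kd c = Some (\sum_(v <= u < v + nvars kd) e u)%N; last by [].
case: kd def_c {def_p S} => /=; rewrite ?addn1 ?addn2 !(big_nat_recl, big_geq) //= ?addn0.
- by case: (e v) (e v.+1) => [|[|[|a]]] [|[|[|b]]] // [<-].
- by case: (e v) => [|[|a]] // [<-].
- by case: (e v) => [|[|[|a]]] // [<-].
Qed.

Section Codes.
Variables (k : fieldType) (n r : nat) (f : 'I_r -> {mpoly k[n]}).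
Let inI := in_ideal f.

Definition var v : {mpoly k[n]} := if insub v is Some i then 'X_(i : 'I_n) else 0.

Definition code_mpoly kd v (c : nat) : {mpoly k[n]} :=
  match kd with
  | Pair => nth 0 [:: 1; var v; var v.+1; var v ^+ 2] c
  | Square => nth 0 [:: 1; var v] c
  | Cube => nth 0 [:: 1; var v; var v ^+ 2] c
  end.

Definition kind_gens kd v : seq {mpoly k[n]} :=
  match kd with
  | Pair => [:: var v * var v.+1; var v ^+ 2 - var v.+1 ^+ 2]
  | Square => [:: var v ^+ 2]
  | Cube => [:: var v ^+ 3]
  end.

Fixpoint gens (L : seq kind) v : seq {mpoly k[n]} :=
  if L is kd :: L' then kind_gens kd v ++ gens L' (v + nvars kd)%N else [::].

Fixpoint codes_mpoly (L : seq kind) v p : {mpoly k[n]} :=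
  match L, p with
  | [::], _ => 1
  | kd :: L', c :: p' => code_mpoly kd v c * codes_mpoly L' (v + nvars kd)%N p'
  | _, _ => 0
  end.

Definition ocodes_mpoly L v (o : option (seq nat)) : {mpoly k[n]} :=
  if o is Some p then codes_mpoly L v p else 0.

Definition ocode_mpoly kd v (o : option nat) : {mpoly k[n]} :=
  if o is Some c then code_mpoly kd v c else 0.

Lemma in_ideal_mulB (p1 p2 q1 q2 : {mpoly k[n]}) :
  inI (p1 - q1) -> inI (p2 - q2) -> inI (p1 * p2 - q1 * q2).
Proof.
move=> I1 I2; have -> : p1 * p2 - q1 * q2 = p2 * (p1 - q1) + q1 * (p2 - q2) by ring.
by apply: in_idealD; apply: in_idealM.
Qed.

Let inI0 (p : {mpoly k[n]}) : p = 0 -> inI p.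
Proof. by move->; exact: in_ideal0. Qed.

Let inI2 (g1 g2 p1 p2 p : {mpoly k[n]}) : inI g1 -> inI g2 -> p = p1 * g1 + p2 * g2 -> inI p.
Proof. by move=> I1 I2 ->; apply: in_idealD; apply: in_idealM. Qed.

Let inI1 (g1 p1 p : {mpoly k[n]}) : inI g1 -> p = p1 * g1 -> inI p.
Proof. by move=> I1 ->; apply: in_idealM. Qed.

(** In a pair all products of degree three vanish, by x^3 = x(x^2 - y^2) + y(xy) and y x^2 =
    x(xy). *)
Lemma code_mul_mod kd v a b : (forall g, g \in kind_gens kd v -> inI g) ->
  inI (code_mpoly kd v a * code_mpoly kd v b - ocode_mpoly kd v (code_mul kd a b)).
Proof.
case: a => [|a] gI; first by case: kd {gI} => /=; rewrite mul1r subrr; exact: inI0.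
case: b => [|b].
  by case: kd {gI} => /=; [case: a => [|[|[|a]]]|case: a => [|a]|case: a => [|[|a]]];
     rewrite mulr1 subrr; exact: inI0.
case: kd gI => /= gI.
- have xy : inI (var v * var v.+1) by apply: gI; rewrite inE eqxx.
  have xx : inI (var v ^+ 2 - var v.+1 ^+ 2) by apply: gI; rewrite !inE eqxx orbT.
  case: a => [|[|[|a]]] /=; case: b => [|[|[|b]]] /=;
    rewrite ?nth_nil ?mulr0 ?mul0r ?subr0; try (by apply: inI0; ring).
  + by apply: (inI1 (p1 := 1) xy); ring.
  + by apply: (inI2 (p1 := var v.+1) (p2 := var v) xy xx); ring.
  + by apply: (inI1 (p1 := 1) xy); ring.
  + by apply: (inI1 (p1 := -1) xx); ring.
  + by apply: (inI1 (p1 := var v) xy); ring.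
  + by apply: (inI2 (p1 := var v.+1) (p2 := var v) xy xx); ring.
  + by apply: (inI1 (p1 := var v) xy); ring.
  + by apply: (inI2 (p1 := var v * var v.+1) (p2 := var v ^+ 2) xy xx); ring.
- have xx : inI (var v ^+ 2) by apply: gI; rewrite inE eqxx.
  case: a => [|a] /=; case: b => [|b] /=; rewrite ?nth_nil ?mulr0 ?mul0r ?subr0;
    try (by apply: inI0).
  by apply: (inI1 (p1 := 1) xx); ring.
- have x3 : inI (var v ^+ 3) by apply: gI; rewrite inE eqxx.
  case: a => [|[|a]] /=; case: b => [|[|b]] /=; rewrite ?nth_nil ?mulr0 ?mul0r ?subr0;
    try (by apply: inI0; ring).
  + by apply: (inI1 (p1 := 1) x3); ring.
  + by apply: (inI1 (p1 := 1) x3); ring.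
  + by apply: (inI1 (p1 := var v) x3); ring.
Qed.

Lemma codes_mul_mod L v p q : (forall g, g \in gens L v -> inI g) ->
  inI (codes_mpoly L v p * codes_mpoly L v q - ocodes_mpoly L v (codes_mul L p q)).
Proof.
elim: L v p q => [|kd L IHL] v p q gI /=; first by apply: inI0; ring.
case: p => [|a p]; first by apply: inI0; rewrite /=; ring.
case: q => [|b q]; first by apply: inI0; rewrite /=; ring.
have gI1 g : g \in kind_gens kd v -> inI g by move=> gk; apply: gI; rewrite mem_cat gk.
have {gI IHL} I2 := IHL (v + nvars kd)%N p q
  (fun g gL => gI g (etrans (mem_cat _ _ _) (introT orP (or_intror gL)))).
have := in_ideal_mulB (code_mul_mod a b gI1) I2.
set o := (X in inI X -> _); set o' := (X in _ -> inI X); suff -> : o' = o by [].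
rewrite {}/o {}/o'; case: code_mul => [c|] /=; last by ring.
by case: codes_mul => [s|] /=; ring.
Qed.

Definition kind_mono kd (e : nat -> nat) v : {mpoly k[n]} :=
  if kd is Pair then var v ^+ e v * var v.+1 ^+ e v.+1 else var v ^+ e v.

Lemma code_of_mod kd e v : (forall g, g \in kind_gens kd v -> inI g) ->
  inI (kind_mono kd e v - ocode_mpoly kd v (code_of kd e v)).
Proof.
case: kd => /= gI.
- have xy : inI (var v * var v.+1) by apply: gI; rewrite inE eqxx.
  have xx : inI (var v ^+ 2 - var v.+1 ^+ 2) by apply: gI; rewrite !inE eqxx orbT.
  case: (e v) => [|[|[|a]]]; case: (e v.+1) => [|[|[|b]]] /=; try (by apply: inI0; ring).
  + by apply: (inI1 (p1 := -1) xx); ring.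
  + apply: (inI2 (p1 := var v.+1 ^+ b * var v) (p2 := - var v.+1 ^+ b * var v.+1) xy xx).
    by rewrite !exprS; ring.
  + by apply: (inI1 (p1 := 1) xy); ring.
  + by apply: (inI1 (p1 := var v.+1) xy); ring.
  + by apply: (inI1 (p1 := var v.+1 ^+ b.+2) xy); rewrite !exprS; ring.
  + by apply: (inI1 (p1 := var v) xy); ring.
  + by apply: (inI1 (p1 := var v * var v.+1) xy); ring.
  + by apply: (inI1 (p1 := var v * var v.+1 ^+ b.+2) xy); rewrite !exprS; ring.
  + apply: (inI2 (p1 := var v ^+ a * var v.+1) (p2 := var v ^+ a * var v) xy xx).
    by rewrite !exprS; ring.
  + by apply: (inI1 (p1 := var v ^+ a.+2) xy); rewrite !exprS; ring.
  + by apply: (inI1 (p1 := var v ^+ a.+2 * var v.+1) xy); rewrite !exprS; ring.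
  + by apply: (inI1 (p1 := var v ^+ a.+2 * var v.+1 ^+ b.+2) xy); rewrite !exprS; ring.
- have xx : inI (var v ^+ 2) by apply: gI; rewrite inE eqxx.
  case: (e v) => [|[|a]] /=; try (by apply: inI0; ring).
  by apply: (inI1 (p1 := var v ^+ a) xx); rewrite !exprS; ring.
- have x3 : inI (var v ^+ 3) by apply: gI; rewrite inE eqxx.
  case: (e v) => [|[|[|a]]] /=; try (by apply: inI0; ring).
  by apply: (inI1 (p1 := var v ^+ a) x3); rewrite !exprS; ring.
Qed.

Lemma codes_of_mod L e v : (forall g, g \in gens L v -> inI g) ->
  inI (\prod_(v <= u < v + nvars_all L) var u ^+ e u - ocodes_mpoly L v (codes_of L e v)).
Proof.
elim: L v => [|kd L IHL] v gI.
  by rewrite /nvars_all /= addn0 big_geq //; exact: inI0 (subrr _).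
have gI1 g : g \in kind_gens kd v -> inI g by move=> gk; apply: gI; rewrite mem_cat gk.
have {gI IHL} I2 := IHL (v + nvars kd)%N
  (fun g gL => gI g (etrans (mem_cat _ _ _) (introT orP (or_intror gL)))).
have := in_ideal_mulB (code_of_mod e gI1) I2.
set o := (X in inI X -> _); set o' := (X in _ -> inI X); suff -> : o' = o by [].
rewrite {}/o {}/o' /nvars_all /= addnA (big_cat_nat (n := (v + nvars kd)%N)) ?leq_addr //=.
congr (_ * _ - _).
  by case: kd {gI1 I2}; rewrite /= ?addn1 ?addn2 !(big_nat_recl, big_geq) //= ?mulr1.
case: code_of => [c|] /=; last by rewrite mul0r.
by case: codes_of => [p|] //=; rewrite mulr0.
Qed.

(** Supplies the covering hypothesis of [hdim_le_blocks]. *)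
Lemma mpolyX_codes L m : nvars_all L = n -> (forall g, g \in gens L 0 -> inI g) ->
  inI 'X_[m] \/ exists p, codes_deg L p = Some (mdeg m) /\ inI ('X_[m] - codes_mpoly L 0 p).
Proof.
move=> eqn gI; pose e v := if insub v is Some i then m (i : 'I_n) else 0%N.
have := codes_of_mod e gI; have := @codes_of_deg L e 0; rewrite add0n eqn.
have -> : \prod_(0 <= u < n) var u ^+ e u = 'X_[m].
  by rewrite big_mkord mpolyXE_id; apply: eq_bigr => i _; rewrite /var /e valK.
have -> : (\sum_(0 <= u < n) e u)%N = mdeg m.
  by rewrite big_mkord mdegE; apply: eq_bigr => i _; rewrite /e valK.
case: codes_of => [p|] /= deg_p; last by rewrite subr0; left.
by right; exists p; split=> //; apply: deg_p.
Qed.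

Lemma var_homog v : var v \is 1.-homog.
Proof.
rewrite /var; case: insubP => [i _ _|_]; last exact: dhomog0.
by rewrite dhomogX /= mdeg1.
Qed.

Lemma var2_homog v : var v ^+ 2 \is 2.-homog.
Proof. exact: dhomogMn (var_homog v). Qed.

Lemma code_mpoly_homog kd v c i : code_deg kd c = Some i -> code_mpoly kd v c \is i.-homog.
Proof.
case: kd; [case: c => [|[|[|[|c]]]]|case: c => [|[|c]]|case: c => [|[|[|c]]]];
  move=> //= -[<-];
    first [exact: dhomog1 | exact: var_homog | exact: var2_homog].
Qed.

Lemma codes_mpoly_homog L v p i : codes_deg L p = Some i -> codes_mpoly L v p \is i.-homog.
Proof.
elim: L v p i => [|kd L IHL] v [|c p] i //=; first by case=> <-; exact: dhomog1.
case def_a: code_deg => [a|//]; case def_b: codes_deg => [b|//] [<-].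
by apply: dhomogM; [apply: code_mpoly_homog | apply: IHL].
Qed.

Definition kind_deg kd : nat := if kd is Cube then 3 else 2.

Lemma gens_homog L v d g : all (fun kd => kind_deg kd == d) L -> g \in gens L v -> g \is d.-homog.
Proof.
elim: L v => //= kd L IHL v /andP[/eqP def_d degL]; rewrite mem_cat => /orP[|gL]; last first.
  by apply: IHL gL.
rewrite -def_d; case: kd {def_d} => /=; rewrite !inE; [case/orP=> /eqP-> | move/eqP-> | move/eqP->].
- by have := dhomogM (var_homog v) (var_homog v.+1).
- by apply: rpredB; exact: var2_homog.
- exact: var2_homog.
- by have := dhomogMn 3 (var_homog v).
Qed.

Lemma size_gens L v : size (gens L v) = nvars_all L.
Proof. by elim: L v => //= kd L IHL v; rewrite size_cat IHL; case: kd. Qed.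
End Codes.

(* Structural recursions, cheaper than the subtraction and the comparison of    *)
(* ssrnat when the kernel reduces them lazily.                                  *)
Definition osub (a b : nat) : option nat :=
  (fix osub a b := match b, a with
   | 0, _ => Some a | b'.+1, a'.+1 => osub a' b' | _, _ => None end)%N a b.

Lemma osubE a b : osub a b = if (b <= a)%N then Some (a - b)%N else None.
Proof. by rewrite /osub; elim: b a => [|b IHb] [|a] //=; rewrite IHb. Qed.

Fixpoint eqn_nat (a b : nat) : bool :=
  match a, b with 0, 0 => true | a'.+1, b'.+1 => eqn_nat a' b' | _, _ => false end%N.

Lemma eqn_natE a b : eqn_nat a b = (a == b).
Proof. by elim: a b => [|a IHa] [|b] //=; rewrite IHa. Qed.

Definition add_mod (g a b : nat) : nat :=
  let s := (a + b)%N in match osub s g with None => s | Some s' => s' end.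

Lemma add_mod_lt g a b : (a < g)%N -> (b < g)%N -> (add_mod g a b < g)%N.
Proof. by move=> ltag ltbg; rewrite /add_mod osubE; case: ifP; lia. Qed.

(** Pruning empty nodes keeps a trie limited to the branches that reach its own block. *)
Definition node (t0 t1 t2 t3 : trie) : trie :=
  match t0, t1, t2, t3 with TE, TE, TE, TE => TE | _, _, _, _ => TN t0 t1 t2 t3 end.

Lemma tget_node p t0 t1 t2 t3 : tget p (node t0 t1 t2 t3) = tget p (TN t0 t1 t2 t3).
Proof.
case: p => [|c p]; first by case: t0 t1 t2 t3 => [|?|????] [|?|????] [|?|????] [|?|????].
by case: t0 t1 t2 t3 => [|?|????] [|?|????] [|?|????] [|?|????] //=;
  case: c => [|[|[|[|c]]]]; case: p.
Qed.

(* Each factor comes with the weights in Z/g of its codes 1, 2 and 3. *)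
Definition layout := seq (kind * (nat * nat * nat)).

(* The basis elements of degree deg whose weight, added to wt, is chi. *)
Fixpoint build (g : nat) (L : layout) (deg wt chi : nat) : trie :=
  match L with
  | [::] => match deg with 0 => if eqn_nat wt chi then TL false else TE | _ => TE end
  | (kd, (w1, w2, w3)) :: L' =>
    let child c w :=
      match code_deg kd c with
      | None => TE
      | Some e => match osub deg e with
                  | None => TE | Some deg' => build g L' deg' (add_mod g wt w) chi end
      end in
    node (child 0 0) (child 1 w1) (child 2 w2) (child 3 w3)
  end%N.

Definition code_weight (w : nat * nat * nat) (c : nat) : nat :=
  let: (w1, w2, w3) := w in nth 0%N [:: 0; w1; w2; w3]%N c.

Fixpoint codes_weight (g : nat) (L : layout) (wt : nat) (p : seq nat) : nat :=
  match L, p with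
  | (_, w) :: L', c :: p' => codes_weight g L' (add_mod g wt (code_weight w c)) p'
  | _, _ => wt
  end.

Lemma tget_build g L deg wt chi p : tget p (build g L deg wt chi) =
  if (codes_deg (unzip1 L) p == Some deg) && (codes_weight g L wt p == chi)
  then Some false else None.
Proof.
elim: L deg wt p => [|[kd [[w1 w2] w3]] L IHL] deg wt p /=.
  by case: deg => [|deg]; rewrite ?eqn_natE; case: p => [|c p] //=; case: eqP.
rewrite tget_node; case: p => [|c p] //=.
have child w : tget p (match code_deg kd c with
      | None => TE
      | Some e => match osub deg e with
                  | None => TE | Some deg' => build g L deg' (add_mod g wt w) chi end end)
  = if (match code_deg kd c, codes_deg (unzip1 L) p with
       Some a, Some b => Some (a + b)%N | _, _ => None end == Some deg)
      && (codes_weight g L (add_mod g wt w) p == chi) then Some false else None.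
  case: code_deg => [e|]; last by case: p.
  rewrite osubE; case: leqP => [lee|lte].
    rewrite IHL; case: codes_deg => [b|] //=.
    congr (if _ && _ then _ else _).
    by apply/eqP/eqP => -[]; [move=> ->|move=> <-]; rewrite ?subnKC ?addKn.
  have -> : tget p TE = None by case: p.
  case: codes_deg => [b|] //=; case: eqP => // -[def_deg]; move: lte.
  by rewrite -def_deg ltnNge leq_addr.
case: c child => [|[|[|[|c]]]] child; rewrite /= ?child //.
have -> : code_deg kd c.+4 = None by case: kd {child}.
by [].
Qed.

Lemma codes_weight_lt g L wt p : (wt < g)%N ->
  all (fun l => let: (w1, w2, w3) := l.2 in [&& w1 < g, w2 < g & w3 < g])%N L ->
  (codes_weight g L wt p < g)%N.
Proof.
elim: L wt p => [|[kd [[w1 w2] w3]] L IHL] wt [|c p] //= ltwt /andP[/and3P[lt1 lt2 lt3] ltL].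
apply: IHL => //; apply: add_mod_lt => //.
by case: c => [|[|[|[|c]]]] //=; rewrite ?nth_nil //; apply: leq_ltn_trans ltwt.
Qed.

Fixpoint toggles (L : seq kind) (m : seq nat) (F : seq (seq nat)) (t : trie) : option trie :=
  match F with
  | [::] => Some t
  | u :: F' => match codes_mul L m u with
               | None => toggles L m F' t
               | Some q => match tget q t with
                           | None => None | Some _ => toggles L m F' (toggle q t) end
               end
  end.

(* The product of the form with terms j.1 and the monomial j.2. If a term falls *)
(* outside of t, the row is dropped, so that no homogeneity has to be proved.   *)
Definition product_row (L : seq kind) (t : trie) (j : seq (seq nat) * seq nat) : brow :=
  match toggles L j.2 j.1 t with None => RZ | Some t' => row_of t' RZ end.

Fixpoint pick_pos (T : Type) (b : positive) (s : seq T) : seq T :=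
  match s with
  | [::] => [::]
  | x :: s' => match b with
               | xH => [:: x] | xO b' => pick_pos b' s' | xI b' => x :: pick_pos b' s' end
  end.

Definition pick_bits (T : Type) (b : N) (s : seq T) : seq T :=
  match b with N0 => [::] | Npos b' => pick_pos b' s end.

Lemma mem_pick_bits (T : eqType) b (s : seq T) x : x \in pick_bits b s -> x \in s.
Proof.
case: b => //= b; elim: s b => [|y s IHs] [b|b|] //=.
- by rewrite !inE => /orP[-> //|/IHs ->]; rewrite orbT.
- by move/IHs; rewrite inE => ->; rewrite orbT.
- by rewrite !inE => ->.
Qed.

(** A form of weight [F.1] lands in block chi when multiplied by monomials of weight chi - [F.1] mod
    g, which is the index used into [low]. *)
Definition block_corank g (L : layout) (i chi : nat) (low : seq (seq (seq nat)))
    (Fs : seq (nat * seq (seq nat))) (b : N) : nat :=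
  let K := unzip1 L in
  let t := build g L i 0 chi in
  let n := size (paths t) in
  let jobs :=
    flatten [seq [seq (F.2, m) | m <- nth [::] low (add_mod g chi (g - F.1))] | F <- Fs] in
  corank n (nseq n None) [seq product_row K t j | j <- pick_bits b jobs].

Definition extra_forms g (L : layout) (d : nat) (cs : seq (nat * N)) : seq (nat * seq (seq nat)) :=
  [seq (c.1, pick_bits c.2 (paths (build g L d 0 c.1))) | c <- cs].

Definition sample_corank g (L : layout) (d i : nat) (cs : seq (nat * N)) (bs : seq N) : nat :=
  let low := [seq rev (paths (build g L (i - d) 0 chi)) | chi <- iota 0 g] in
  let Fs := extra_forms g L d cs in
  sumn [seq block_corank g L i chi low Fs (nth N0 bs chi) | chi <- iota 0 g].

Definition nproducts (L : seq kind) (m : seq nat) (F : seq (seq nat)) (q : seq nat) : nat :=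
  count (fun u => codes_mul L m u == Some q) F.

Lemma toggles_spec L m F t t' : toggles L m F t = Some t' ->
  [/\ paths t' = paths t,
      forall q, q \in paths t -> odflt false (tget q t') =
        odd (nproducts L m F q) (+) odflt false (tget q t)
    & forall u q, u \in F -> codes_mul L m u = Some q -> q \in paths t].
Proof.
elim: F t => [|u F IHF] t /=; first by case=> <-; split.
case def_q: codes_mul => [q|]; last first.
  move/IHF => [eqp getp memp]; split=> // u' q'.
  by rewrite inE => /predU1P[-> | u'F]; [rewrite def_q | exact: memp].
case get_q: tget => [b|//] /IHF; rewrite paths_toggle => -[-> getp memp].
split=> // [q' q'p|u' q']; last first.
  rewrite inE => /predU1P[-> | u'F]; last exact: memp.
  by rewrite def_q => -[<-]; rewrite mem_paths get_q.
rewrite getp // (tget_toggle _ get_q) /nproducts /= (inj_eq (@Some_inj _)) [q == q']eq_sym.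
have [->|_] //= := eqVneq q' q; rewrite get_q oddD /=.
by case: b {get_q}; case: odd.
Qed.

Lemma F2_intr_odd (z : int) : z%:~R = (odd `|z|)%:R :> 'F_2.
Proof.
have nat2 (j : nat) : j%:R = (odd j)%:R :> 'F_2.
  rewrite -{1}[j]odd_double_half natrD -mul2n natrM (_ : 2%:R = 0) ?mul0r ?addr0 //.
  exact: val_inj.
case: z => j; first exact: nat2.
rewrite NegzE mulrNz; have -> : j.+1%:~R = (odd j.+1)%:R :> 'F_2 by exact: nat2.
by case: odd; apply: val_inj.
Qed.

(** * Soundness of the computed coranks *)

Section Sound.
Variables (k : fieldType) (n r : nat) (f : 'I_r -> {mpoly k[n]}).
Let inI := in_ideal f.

(** The integer [w l] counts the terms of F that m sends to the l-th basis element, and the computed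
    bit is its parity. The row over F_2 thus lifts to a relation over k; a dropped row lifts to
    0. *)
Lemma product_row_spec L t F m :
    (forall q, odflt false (tget q t) = false) -> (forall g, g \in gens k n L 0 -> inI g) ->
    inI (\sum_(u <- F) codes_mpoly k n L 0 u) ->
  exists w : nat -> int,
    (forall l, nth false (bits (product_row L t (F, m))) l = odd `|w l|) /\
    inI (\sum_(l < size (paths t)) (w l)%:~R *: codes_mpoly k n L 0 (nth [::] (paths t) l)).
Proof.
move=> t0 gI FI; rewrite /product_row /=; case def_t': toggles => [t'|]; last first.
  exists (fun=> 0); split=> [l|]; first by rewrite nth_nil.
  by rewrite big1 => [|l _]; [exact: in_ideal0 | rewrite scale0r].
have [eqp getp memp] := toggles_spec def_t'.
pose w l : int := if (l < size (paths t))%N then (nproducts L m F (nth [::] (paths t) l))%:Z else 0.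
exists w; split=> [l|].
  rewrite bits_row_of cats0 eqp /w; case: ltnP => [ltl|lel]; last by rewrite nth_default ?size_map.
  by rewrite (nth_map [::]) // getp ?mem_nth // t0 addbF.
have -> : \sum_(l < size (paths t)) (w l)%:~R *: codes_mpoly k n L 0 (nth [::] (paths t) l)
  = \sum_(u <- F) ocodes_mpoly k n L 0 (codes_mul L m u).
  transitivity (\sum_(q <- paths t) (nproducts L m F q)%:R *: codes_mpoly k n L 0 q).
    by rewrite (big_nth [::]) big_mkord; apply: eq_bigr => l _; rewrite /w ltn_ord.
  rewrite (eq_bigr (fun q => \sum_(u <- F)
      (codes_mul L m u == Some q)%:R *: codes_mpoly k n L 0 q)); last first.
    move=> q _; rewrite -scaler_suml -natr_sum; congr (_%:R *: _).
    by rewrite /nproducts -sum1_count big_mkcond; apply: eq_bigr => u _; case: eqP.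
  rewrite exchange_big /= big_seq [RHS]big_seq; apply: eq_bigr => u uF.
  case def_q: codes_mul => [q0|] /=; last by rewrite big1 // => q _; rewrite scale0r.
  rewrite (bigD1_seq q0) ?uniq_paths ?(memp _ _ uF def_q) //= eqxx scale1r big1 ?addr0 // => q ne.
  by rewrite (inj_eq (@Some_inj _)) eq_sym (negPf ne) scale0r.
(* The table product differs from the true product m F by an element of the ideal, term by term. *)
have -> : \sum_(u <- F) ocodes_mpoly k n L 0 (codes_mul L m u) =
    codes_mpoly k n L 0 m * (\sum_(u <- F) codes_mpoly k n L 0 u) -
    \sum_(u <- F) (codes_mpoly k n L 0 m * codes_mpoly k n L 0 u -
      ocodes_mpoly k n L 0 (codes_mul L m u)).
  by rewrite sumrB -mulr_sumr opprB addrCA subrr addr0.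
apply: in_idealB; first exact: in_idealM.
by apply: in_ideal_sum => u _; apply: codes_mul_mod.
Qed.

Lemma block_corank_spec g (L : layout) i chi low Fs b :
    [pchar k] =i pred0 -> (forall g, g \in gens k n (unzip1 L) 0 -> inI g) ->
    (forall F, F \in Fs -> inI (\sum_(u <- F.2) codes_mpoly k n (unzip1 L) 0 u)) ->
  let T := paths (build g L i 0 chi) in
  exists a (M : 'M[k]_(a, size T)),
    (forall u, inI (\sum_l M u l *: codes_mpoly k n (unzip1 L) 0 (nth [::] T l))) /\
    (size T - \rank M <= block_corank g L i chi low Fs b)%N.
Proof.
move=> chark gI FI T; rewrite /block_corank; set jobs := flatten _.
set js := pick_bits b jobs; set K := unzip1 L; set t := build g L i 0 chi.
have t0 q : odflt false (tget q t) = false by rewrite tget_build; case: ifP.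
have row_js (u : 'I_(size js)) : exists w : nat -> int,
    (forall l, nth false (bits (product_row K t (nth ([::], [::]) js u))) l = odd `|w l|) /\
    inI (\sum_(l < size T) (w l)%:~R *: codes_mpoly k n K 0 (nth [::] T l)).
  have /mem_pick_bits/flattenP[s /mapP[F FFs ->] /mapP[m _ ->]] : nth ([::], [::]) js u \in js.
    exact: mem_nth.
  by apply: product_row_spec => //; apply: FI.
have [w w_spec] := fin_all_exists row_js.
pose M : 'M[int]_(size js, size T) := \matrix_(u, l) w u l.
exists (size js), (map_mx intr M); split=> [u|].
  have [_ Iu] := w_spec u.
  rewrite (eq_bigr (fun l : 'I_(size T) =>
    (w u l)%:~R *: codes_mpoly k n K 0 (nth [::] T l))) // => l _.
  by rewrite !mxE.
(* Elimination works on the reduction mod 2 of the integer relations M. *)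
apply: leq_trans (leq_sub2l _ (mxrank_mod2 M chark)) _.
apply: corank_leq.
- by rewrite size_nseq.
- exact: valid_nseq.
- by rewrite /npivots count_nseq mul0n addn0.
move=> j; rewrite size_map => ltj; rewrite (nth_map ([::], [::])) //.
have [w_odd _] := w_spec (Ordinal ltj).
rewrite (_ : bitvec _ _ _ = row (Ordinal ltj) (map_mx intr M)) ?row_sub //.
by apply/rowP=> l; rewrite !mxE subn0 w_odd F2_intr_odd.
Qed.
End Sound.

Section Attains.
Variable k : fieldType.
Hypothesis chark : [pchar k] =i pred0.

Lemma sumn_iota (c : nat -> nat) g : sumn [seq c j | j <- iota 0 g] = (\sum_(j < g) c j)%N.
Proof. by rewrite sumnE big_map -{1}[g]subn0 big_mkord. Qed.

Lemma sample_attains n d i g (L : layout) cs bs :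
    (0 < g)%N -> nvars_all (unzip1 L) = n -> all (fun kd => kind_deg kd == d) (unzip1 L) ->
    all (fun l => let: (w1, w2, w3) := l.2 in [&& w1 < g, w2 < g & w3 < g])%N L ->
  attains k n d (n + size cs) i (sample_corank g L d i cs bs)%:R.
Proof.
move=> g0 nL dL wL; pose K := unzip1 L; pose Fs := extra_forms g L d cs.
pose fs := gens k n K 0 ++ [seq \sum_(u <- F.2) codes_mpoly k n K 0 u | F <- Fs].
pose f j := nth 0 fs j; have szfs : size fs = (n + size cs)%N.
  by rewrite size_cat size_gens nL !size_map.
have hf j : f j \is d.-homog.
  rewrite /f; have [ltj|lej] := ltnP j (size fs); last by rewrite nth_default // dhomog0.
  have := mem_nth 0 ltj; move: (nth 0 fs j) => p; rewrite mem_cat => /orP[|].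
    exact: gens_homog.
  case/mapP=> _ /mapP[c _ ->] -> /=; rewrite big_seq; apply: rpred_sum => u.
  move/mem_pick_bits; rewrite mem_paths tget_build; case: ifP => // /andP[/eqP deg_u _] _.
  exact: codes_mpoly_homog.
have fI p : p \in fs -> in_ideal (fun j : 'I_(n + size cs) => f j) p.
  move=> pfs; have ltj : (index p fs < n + size cs)%N by rewrite -szfs index_mem.
  rewrite -(nth_index 0 pfs) -/(f _).
  exact: (@in_ideal_gen _ _ _ (fun j : 'I_(n + size cs) => f j) (Ordinal ltj)).
have gI p : p \in gens k n K 0 -> in_ideal (fun j : 'I_(n + size cs) => f j) p.
  by move=> pg; apply: fI; rewrite mem_cat pg.
have FI F : F \in Fs ->
    in_ideal (fun j : 'I_(n + size cs) => f j) (\sum_(u <- F.2) codes_mpoly k n K 0 u).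
  by move=> FFs; apply: fI; rewrite mem_cat map_f ?orbT.
exists f; split=> //; rewrite ler_nat /sample_corank.
set low := [seq rev _ | chi <- iota 0 g].
rewrite (sumn_iota (fun chi => block_corank g L i chi low (extra_forms g L d cs) (nth N0 bs chi))).
have block (chi : 'I_g) := block_corank_spec g i chi low (nth N0 bs chi) chark gI FI.
have [a /fin_all_exists[M M_spec]] := fin_all_exists block.
pose T chi := paths (build g L i 0 chi).
apply: leq_trans (@hdim_le_blocks _ _ _ _ _ _ hf _ (fun chi : 'I_g => size (T chi)) a
  (fun chi l => codes_mpoly k n K 0 (nth [::] (T chi) l)) M _ _) _.
- by move=> chi u; have [+ _] := M_spec chi; apply.
- move=> m dm; have [Im|[p [deg_p Ip]]] := mpolyX_codes m nL gI; first by left.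
  (* A basis monomial belongs to the block of its own weight, which is below g. *)
  right; have lt_chi := codes_weight_lt p g0 wL; exists (Ordinal lt_chi).
  have pT : p \in T (Ordinal lt_chi).
    by rewrite mem_paths tget_build deg_p dm !eqxx.
  exists (Ordinal (etrans (index_mem p (T (Ordinal lt_chi))) pT)).
  by rewrite nth_index.
by apply: leq_sum => chi _; have [_] := M_spec chi.
Qed.

(** Together with [hcoef_diag] this settles degree d without computation: taking all monomials
    serves for both R d and S d. *)
Lemma attains_all_forms n d : (0 < n)%N -> (0 < d)%N -> attains k n d (ndim n d) d 0.
Proof.
move=> n0 d0; pose f j : {mpoly k[n]} := if insub j is Some l then 'X_[@mon n d l] else 0.
have hf j : f j \is d.-homog.
  by rewrite /f; case: insubP => [l _ _|_]; [exact: mpolyX_mon_homog | exact: dhomog0].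
exists f; split=> //; suff -> : hdim d f (ndim n d) d = 0%N by [].
apply/hdim_eq0P => // p hp; rewrite (vpoly_eq_sum hp); apply: in_ideal_sum => l _.
apply: in_idealZ; have -> : 'X_[mon l] = f l by rewrite /f valK.
exact: (@in_ideal_gen _ _ _ (fun j : 'I_(ndim n d) => f j) l).
Qed.

Lemma hcoef_diag n d r : (0 < n)%N -> (0 < d)%N -> hcoef n d r d = (ndim n d)%:Z - r%:Z.
Proof.
move=> n0 d0; elim: r => [|r IHr]; first by rewrite hcoef0_ndim // subr0 natz.
have ndim0 : ndim n 0 = 1%N by rewrite /ndim bin0.
by rewrite hcoefS leqnn subnn IHr hcoef_lt // ndim0; lia.
Qed.
End Attains.

(** * Numerical tables *)

Fixpoint prefix_sums (acc : Z) (s : seq Z) : seq Z :=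
  if s is x :: s' then Z.add acc x :: prefix_sums (Z.add acc x) s' else [::].

Definition hcoef_step (d : nat) (s : seq Z) : seq Z :=
  mkseq (fun i => if (d <= i)%N then Z.sub (nth Z0 s i) (nth Z0 s (i - d))
                  else nth Z0 s i) (size s).

(** The constant sequence 1 is 1/(1 - t); each prefix sum divides by 1 - t once more, and each
    [hcoef_step] multiplies by 1 - t^d, all modulo t^D. *)
Definition hcoef_seq (n d r D : nat) : seq Z :=
  iter r (hcoef_step d) (iter n.-1 (prefix_sums Z0) (nseq D (Zpos xH))).

Lemma size_prefix_sums acc s : size (prefix_sums acc s) = size s.
Proof. by elim: s acc => //= x s IHs acc; rewrite IHs. Qed.

Lemma nth_prefix_sumsS acc s i : (i.+1 < size s)%N ->
  nth Z0 (prefix_sums acc s) i.+1 = Z.add (nth Z0 (prefix_sums acc s) i) (nth Z0 s i.+1).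
Proof.
elim: s acc i => //= x s IHs acc i; rewrite ltnS => lti.
case: i lti => [|i] lti; last exact: IHs.
by case: s lti {IHs}.
Qed.

Lemma int_of_Z_add a b : int_of_Z (Z.add a b) = int_of_Z a + int_of_Z b.
Proof. exact: (rmorphD int_of_Z a b). Qed.

Lemma int_of_Z_sub a b : int_of_Z (Z.sub a b) = int_of_Z a - int_of_Z b.
Proof. exact: (rmorphB int_of_Z a b). Qed.

Lemma nth_hcoef_seq0 n D i : (i < D)%N ->
  int_of_Z (nth Z0 (iter n (prefix_sums Z0) (nseq D (Zpos xH))) i) = 'C((n + i)%N, i)%:R.
Proof.
have sz m : size (iter m (prefix_sums Z0) (nseq D (Zpos xH))) = D.
  by elim: m => [|m IHm]; rewrite ?size_nseq //= size_prefix_sums.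
elim: n i => [|n IHn] i ltiD; first by rewrite nth_nseq ltiD add0n binn.
elim: i ltiD => [|i IHi] ltiD /=.
  have IH0 := IHn 0%N ltiD; move: IH0 (sz n) ltiD.
  by rewrite !bin0; case: (iter n _ _) => [_ <-|].
rewrite nth_prefix_sumsS ?sz // int_of_Z_add IHn //.
have := IHi (ltnW ltiD); rewrite /= => ->.
by rewrite -natrD !addSn binS -addnS addnC.
Qed.

Lemma hcoef_seqE n d r D i : (0 < n)%N -> (i < D)%N ->
  hcoef n d r i = int_of_Z (nth Z0 (hcoef_seq n d r D) i).
Proof.
move=> n0 ltiD; rewrite /hcoef_seq; set s := iter n.-1 _ _.
have sz m : size (iter m (hcoef_step d) s) = D.
  elim: m => [|m IHm] /=; last by rewrite size_mkseq.
  by rewrite /s; elim: n.-1 => [|m IHm]; rewrite ?size_nseq //= size_prefix_sums.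
elim: r i ltiD => [|r IHr] i ltiD /=.
  by rewrite nth_hcoef_seq0 // -{1}(prednK n0) hcoef0.
rewrite nth_mkseq ?sz // hcoefS; case: leqP => _; last by rewrite subr0 IHr.
rewrite int_of_Z_sub !IHr //; exact: leq_ltn_trans (leq_subr _ _) ltiD.
Qed.

(* An extra form is given by its weight and by the mask of its terms among the  *)
(* basis elements of degree d of that weight; picks contains, for each block,   *)
(* the mask of a set of products of extra forms with monomials whose rows are   *)
(* enough to reach the rank.                                                    *)
Record sample := Sample {
  modulus : nat;
  factors : layout;
  extras : seq (nat * N);
  picks : seq N
}.

Section Table.
Variables n d : nat.

Definition nforms (s : sample) : nat := n + size (extras s).

Definition well_formed (s : sample) : bool :=
  [&& (0 < modulus s)%N, nvars_all (unzip1 (factors s)) == n,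
      all (fun kd => kind_deg kd == d) (unzip1 (factors s))
    & all (fun l => let: (w1, w2, w3) := l.2 in
             [&& w1 < modulus s, w2 < modulus s & w3 < modulus s])%N (factors s)].

Definition corank_of (i : nat) (s : sample) : nat :=
  sample_corank (modulus s) (factors s) d i (extras s) (picks s).

Definition hvalue (i : nat) (s : sample) : Z := nth Z0 (hcoef_seq n d (nforms s) i.+1) i.

Definition injective_at (i : nat) (s : sample) : bool :=
  well_formed s && Z.leb (Z.of_nat (corank_of i s)) (hvalue i s).

Definition surjective_at (i : nat) (s : sample) (o : option sample) : bool :=
  if o is Some t then well_formed t && (corank_of i t <= 0)%N else Z.leb (hvalue i s) Z0.

Definition no_sample : sample := Sample 0 [::] [::] [::].

(* Both lists start in degree d + 1. In each degree, inj contains the sample    *)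
(* with the most forms for which a(r, i) >= 0, and surj one for the vanishing   *)
(* of the quotient; None means that a(r, i) = 0, so that the sample of inj      *)
(* serves both purposes. Only surj reaches the last degree.                     *)
Definition good_table (inj : seq sample) (surj : seq (option sample)) : bool :=
  let s j := nth no_sample inj j in
  let o j := nth None surj j in
  [&& all (fun j => [&& injective_at (d.+1 + j) (s j), surjective_at (d.+1 + j) (s j) (o j),
          (nforms (s j) <= if j is j'.+1 then nforms (s j') else ndim n d)%N
        & (nforms (odflt (s j) (o j)) <= (nforms (s j)).+1)%N]) (iota 0 (size inj))
    & if o (size inj) is Some t then
        [&& well_formed t, (nforms t <= n.+1)%N & (corank_of (d.+1 + size inj) t <= 0)%N]
      else false].

Variable k : fieldType.
Hypotheses (chark : [pchar k] =i pred0) (n0 : (0 < n)%N) (d0 : (0 < d)%N).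

Lemma well_formed_attains i s : well_formed s ->
  attains k n d (nforms s) i (corank_of i s)%:R.
Proof. by case/and4P=> g0 /eqP nL dL wL; apply: sample_attains. Qed.

Lemma attains_le r i z z' : z <= z' -> attains k n d r i z -> attains k n d r i z'.
Proof. by move=> lez [F [hF leF]]; exists F; split=> //; apply: le_trans lez. Qed.

Lemma injective_at_attains i s : injective_at i s ->
  attains k n d (nforms s) i (hcoef n d (nforms s) i).
Proof.
case/andP=> wfs leZ; apply: attains_le (well_formed_attains i wfs).
rewrite (@hcoef_seqE n d _ i.+1 i) // -/(hvalue i s).
move: leZ; move: (hvalue i s) (corank_of i s) => z c; lia.
Qed.

Lemma surjective_at_attains i s o : injective_at i s -> surjective_at i s o ->
  attains k n d (nforms (odflt s o)) i 0.
Proof.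
case: o => [t|] /= inj_s.
  by case/andP=> wft; rewrite leqn0 => /eqP cor0; have := well_formed_attains i wft; rewrite cor0.
move=> le0; apply: attains_le (injective_at_attains inj_s).
rewrite (@hcoef_seqE n d _ i.+1 i) // -/(hvalue i s).
by move: le0; move: (hvalue i s) => z; lia.
Qed.

Lemma froberg_good_table inj surj : good_table inj surj -> forall r, froberg k n d r.
Proof.
case/andP=> /allP all_j; case def_t: nth => [t|//] /and3P[wft leSn cor0].
pose D := (d.+1 + size inj)%N; pose s i := nth no_sample inj (i - d.+1).
(* Degree d uses all monomials; the entries of the two lists start in degree d + 1. *)
pose R i := if (d < i)%N then nforms (s i) else ndim n d.
pose S i := if (d < i)%N then nforms (odflt (s i) (nth None surj (i - d.+1))) else ndim n d.
have row_j i : (d < i < D)%N -> [/\ injective_at i (s i),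
    surjective_at i (s i) (nth None surj (i - d.+1)), (R i <= R i.-1)%N & (S i <= (R i).+1)%N].
  case/andP=> ltdi ltiD; have := all_j (i - d.+1)%N; rewrite mem_iota add0n /= ltn_subLR //.
  rewrite -/D ltiD => /(_ isT); rewrite subnKC // -/(s i) => /and4P[inj_i surj_i leR leS].
  split=> //; rewrite /R /S ltdi //; case: ltnP => [ltdi1|lei1d].
    by move: leR; rewrite /s (_ : i - d.+1 = (i.-1 - d.+1).+1)%N //; lia.
  by move: leR; rewrite (_ : i - d.+1 = 0)%N //; lia.
apply: (@froberg_table k n d chark n0 d0 R S D).
- by rewrite /D addSnnS leq_addr.
- move=> i /andP[ledi ltiD]; rewrite /R; case: ltnP => [ltdi|leid].
    by have [|inj_i _ _ _] := row_j i; [rewrite ltdi | exact: injective_at_attains].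
  have -> : i = d by lia.
  by rewrite hcoef_diag // subrr; exact: attains_all_forms.
- move=> i j /andP[ledi leij] ltjD; elim: j leij ltjD => [|j IHj].
    by rewrite leqn0 => /eqP->.
  rewrite leq_eqVlt => /predU1P[-> //|leij] ltjD; have [|_ _ leR _] := row_j j.+1.
    by rewrite ltjD ltnS (leq_trans ledi).
  by apply: leq_trans leR (IHj _ _) => //; apply: ltnW.
- move=> i /andP[ledi leiD]; rewrite /S; case: ltnP => [ltdi|leid]; last first.
    by have -> : i = d by [lia]; exact: attains_all_forms.
  move: leiD; rewrite leq_eqVlt => /predU1P[->|ltiD].
    rewrite {2}/D addKn def_t /=; move: cor0; rewrite leqn0 -/D => /eqP cor0.
    by have := well_formed_attains D wft; rewrite cor0.
  by have [|inj_i surj_i _ _] := row_j i; [rewrite ltdi | exact: surjective_at_attains].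
- move=> i /andP[ledi ltiD]; have [ltdi|leid] := ltnP d i.
    by have [|_ _ _ ->] := row_j i; rewrite ?ltdi.
  by rewrite /R /S ltnNge leid.
- by rewrite /S {1}/D addSn ltnS leq_addr {2}/D addKn def_t.
Qed.
End Table.

(** * Sample data for the three cases *)

Definition inj_12_2 : seq sample := [::
  Sample 4
    [::
    (Pair, (1, 3, 2)); (Pair, (1, 1, 2)); (Pair, (0, 0, 0)); (Pair, (3, 3, 2));
    (Pair, (3, 1, 2)); (Pair, (2, 2, 0))]
    [::
    (3, 0x1ad8%num); (1, 0x3c6f%num); (2, 0x285ab%num); (3, 0x8abf%num); (3, 0x10fa%num);
    (3, 0xe375%num); (1, 0x9dd4%num); (2, 0x294aa%num); (0, 0x837c%num); (1, 0x41f1%num);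
    (0, 0xb2ab%num); (0, 0x7c44%num); (1, 0xc327%num); (2, 0x3d74e%num); (0, 0xc2c5%num);
    (3, 0xa2f0%num); (1, 0x12b2%num); (3, 0xcf5a%num)]
    [::
    0x3ffffffffffffff%num; 0x3ffffffffffff%num; 0x3ffffffffffffff%num; 0x3ffffffffffff%num];
  Sample 4
    [::
    (Pair, (0, 2, 0)); (Pair, (3, 1, 2)); (Pair, (0, 2, 0)); (Pair, (3, 1, 2));
    (Pair, (2, 2, 0)); (Pair, (1, 3, 2))]
    [::
    (0, 0x48b2%num); (0, 0x7114%num); (1, 0x1d220%num); (0, 0x6ac8%num); (3, 0x160a7%num);
    (1, 0x2c01%num); (2, 0x4372%num)]
    [::
    0x3fffbfffff7ffcfffffffefffffff%num; 0xffffc7fffffff7ffcffffffffffff%num;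
    0x23fffdfffffffffffffffffffffff%num; 0xf7ffffff8ffffffffffffffffffff%num];
  Sample 4
    [::
    (Pair, (2, 2, 0)); (Pair, (2, 0, 0)); (Pair, (3, 1, 2)); (Pair, (1, 1, 2));
    (Pair, (3, 3, 2)); (Pair, (0, 2, 0))]
    [::
    (3, 0x113a%num); (0, 0x196e0%num); (1, 0x1ca08%num)]
    [::
    0x2e7bfdffffffffebf7fffffffffffffffffffffff%num;
    0x1aedfffdffffff7ffbfff7ff7fffffffffffffffff%num;
    0xbaedfffbffbffeddffffffffffffffffffffffffff%num;
    0xdcffeffff7ff7fdffffbfffffffffffffffffffff%num];
  Sample 2
    [::
    (Pair, (1, 0, 0)); (Pair, (0, 0, 0)); (Pair, (0, 0, 0)); (Pair, (0, 1, 0));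
    (Pair, (1, 1, 0)); (Pair, (0, 1, 0))]
    [::
    (0, 0x374c26f55%num); (0, 0x43fa3077%num)]
    [::
    0x91f5effaf7fbffaf7fbff7ffc6fffffffffffffebdfeffdfff7fffdfffffffffffffffffffffffffffffffffffffffffffffffffffffffffffffffffff%num;
    0x6fc6fff1bfffff1bffffffffebdfeffdfff7fffc6fffffffffffffffffffffffffffffffffffffffffffffffffffffffffffffffffffffffffffffffff%num]].

Definition surj_12_2 : seq (option sample) := [::
  Some (Sample 4
    [::
    (Pair, (1, 1, 2)); (Pair, (0, 2, 0)); (Pair, (3, 1, 2)); (Pair, (0, 2, 0));
    (Pair, (2, 0, 0)); (Pair, (3, 3, 2))]
    [::
    (0, 0xc068%num); (2, 0xc32%num); (0, 0xb9c7%num); (2, 0x442%num); (3, 0x1624%num);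
    (0, 0x3928%num); (1, 0x3190e%num); (2, 0x2a1%num); (3, 0xaa94%num); (0, 0x1c56%num);
    (1, 0x5549%num); (3, 0x20aaa%num); (2, 0x5f0%num); (0, 0x2aa6%num); (3, 0x14c1f%num);
    (1, 0x13579%num); (2, 0x1700%num); (0, 0x11827%num); (3, 0xc83%num)]
    [::
    0x7fffffffffffff%num; 0x7fffffffffffff%num; 0xbfffffffffffff%num; 0x7fffffffffffff%num]);
  Some (Sample 3
    [::
    (Pair, (0, 0, 0)); (Pair, (2, 2, 1)); (Pair, (1, 1, 2)); (Pair, (1, 1, 2));
    (Pair, (2, 2, 1)); (Pair, (0, 0, 0))]
    [::
    (0, 0x2df601%num); (1, 0x105102%num); (0, 0xa829%num); (1, 0x221406%num);
    (2, 0x2590a4%num); (0, 0x341d65%num); (0, 0x24ca01%num); (2, 0x3244ee%num)]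
    [::
    0x9ffffd3ffff4ffffe7fffffffffdffffffffffffffff%num;
    0xcdfffe7ffff9ffffffffff6ffffefffff7ffffffffff%num;
    0xfdfff7ffffdffffdbffff9fffffffffffffffffffff%num]);
  Some (Sample 4
    [::
    (Pair, (3, 1, 2)); (Pair, (3, 1, 2)); (Pair, (2, 0, 0)); (Pair, (0, 0, 0));
    (Pair, (1, 3, 2)); (Pair, (2, 2, 0))]
    [::
    (2, 0x8b69%num); (0, 0x152b%num); (2, 0xd784%num); (1, 0x2e0cd%num)]
    [::
    0xffefd7f7faffe027ffffffffffcdffffffffffffffffffffffffff%num;
    0xbfffffffffedffdfbfeff7fffbffbfffdfffffffffffffffffff%num;
    0x6febf7f5ff7fe0b7ffffffffffcf7fffffffffffffffffffffffff%num;
    0x17effffffffedffdfefeffefffbffff7fffefffffffffffffffff%num]);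
  None;
  Some (Sample 2
    [::
    (Pair, (0, 1, 0)); (Pair, (1, 0, 0)); (Pair, (1, 1, 0)); (Pair, (0, 0, 0));
    (Pair, (0, 1, 0)); (Pair, (0, 1, 0))]
    [::
    (0, 0x34589572f%num)]
    [::
    0xfffffffffffffffffffffffffffffffffffffffffffffffffffffffffffffffffffffffffffffffffffffffffffffffffff%num;
    0xfffffffffffffffffffffffffffffffffffffffffffffffffffffffffffffffffffffffffffffffffffffffffffffffffff%num])].

(** In degrees 3 to 6 the value a is attained with 30, 19, 15 and 14 quadrics, and the quotient
    vanishes with 31, 20, 16 and 14, since a(14, 6) = 0. In degree 7 it vanishes with 13
    quadrics. *)
Lemma good_table_12_2 : good_table 12 2 inj_12_2 surj_12_2.
Proof. by vm_compute. Qed.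

Definition inj_13_2 : seq sample := [::
  Sample 2
    [::
    (Pair, (0, 0, 0)); (Pair, (1, 0, 0)); (Pair, (1, 1, 0)); (Pair, (1, 0, 0));
    (Pair, (1, 0, 0)); (Pair, (1, 1, 0)); (Square, (0, 0, 0))]
    [::
    (1, 0x928090221%num); (0, 0xe40240a80%num); (0, 0x58406814c0%num); (1, 0x1080968201%num);
    (0, 0x1110241020%num); (1, 0x2082040a%num); (0, 0x2182282100%num); (1, 0x988250001%num);
    (0, 0x2380124040%num); (1, 0x6200120c0%num); (0, 0x4040040006%num); (1, 0x900100086%num);
    (0, 0x400809104%num); (0, 0x200008c020%num); (1, 0x200012a00%num); (1, 0x411820c0%num);
    (0, 0x8020401%num); (0, 0x540a410001%num); (0, 0x101200400%num); (1, 0x2001041%num);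
    (1, 0x196001a62%num); (1, 0x40000dc600%num)]
    [::
    0x7fffffffffffffffffffffffffffffffffff%num; 0x7fffffffffffffffffffffffffffffffffff%num];
  Sample 6
    [::
    (Pair, (3, 3, 0)); (Pair, (5, 2, 4)); (Pair, (2, 5, 4)); (Pair, (1, 4, 2));
    (Pair, (1, 1, 2)); (Pair, (3, 0, 0)); (Square, (3, 0, 0))]
    [::
    (4, 0x1de7b%num); (5, 0x557%num); (1, 0x151%num); (4, 0xf468%num); (5, 0x6e1%num);
    (3, 0x49c%num); (0, 0x5d0b%num); (2, 0x3741%num); (4, 0x7667%num)]
    [::
    0x3ffedfffffffffdfffffbffffffff%num; 0x37f9ffbfdbfffffffffffffffffff%num;
    0x37ffdffffffe7ffffdfffffffffffff%num; 0x1ffbff7fffff6fffbfffffefffffff%num;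
    0x7ffffffb7ffdfeffffffffffffffff%num; 0x3ff7f9fffffffffdfeffffffffff%num];
  Sample 6
    [::
    (Pair, (0, 3, 0)); (Pair, (5, 5, 4)); (Pair, (0, 3, 0)); (Pair, (1, 4, 2));
    (Pair, (5, 2, 4)); (Pair, (3, 3, 0)); (Square, (2, 0, 0))]
    [::
    (2, 0x1f155%num); (4, 0x4b7%num); (0, 0x3ed7%num); (5, 0x1f25%num)]
    [::
    0x5ef7dffff7fceffffffffffdffffdfffffffffffffffff%num;
    0x2bffffbfffff1fbdf7fffdff7ffffffffffffffffffffffff%num;
    0x3d7df7ffdfffaffffefffffddfffffffffffffffffffff%num;
    0x29fffffbffff7efefbfffffef7bffffffbfffffffffffffff%num;
    0xdeefdfffefffdcfffffdfffffdfffffffffffffffffffff%num;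
    0x1d7fffeffff3bdffffffdfffeffefbffffffffffffffffff%num];
  Sample 2
    [::
    (Pair, (1, 1, 0)); (Pair, (0, 0, 0)); (Pair, (0, 1, 0)); (Pair, (0, 1, 0));
    (Pair, (0, 0, 0)); (Pair, (1, 1, 0)); (Square, (0, 0, 0))]
    [::
    (0, 0x3050003120%num); (1, 0x495045480%num)]
    [::
    0x666c5ee5f7d7d7ffff9fdfffefffe7f7fffbfffffff5f5fbfffffdffff7ffffebebf7fffffbfffeffffffffffffffffffffffffffffffffffffffffffffffffffffffffffffffffffffffffffffffffffffffffffffffffffff%num;
    0x7ae8beb89fe7f7dff5f5fbfffffd7d7effffff7ffff9fdfffefffffffffffffe7f7fffbffffffffffffdfffffffffffffffffffffffffffffffffffffffffffffffffffffffffffffffffffffffffffffffffffffffffffffff%num];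
  Sample 2
    [::
    (Pair, (0, 0, 0)); (Pair, (0, 1, 0)); (Pair, (0, 1, 0)); (Pair, (1, 0, 0));
    (Pair, (1, 1, 0)); (Pair, (1, 1, 0)); (Square, (0, 0, 0))]
    [::
    (1, 0x2c8a720301%num)]
    [::
    0x3ffffffffffffffffffffffffffffffffffffffffffffffffffffffffffffffffffffffffffffffffffffffffffffffffffffffffffffffffffffffffffffffffffffffffffffffffffffffffffffffff%num;
    0x1fffffffffffffffffffffffffffffffffffffffffffffffffffffffffffffffffffffffffffffffffffffffffffffffffffffffffffffffffffffffffffffffffffffffffffffffffffffffffffffffff%num]].

Definition surj_13_2 : seq (option sample) := [::
  None;
  Some (Sample 4
    [::
    (Pair, (0, 2, 0)); (Pair, (3, 1, 2)); (Pair, (3, 3, 2)); (Pair, (2, 2, 0));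
    (Pair, (1, 3, 2)); (Pair, (1, 1, 2)); (Square, (2, 0, 0))]
    [::
    (2, 0x64b0%num); (0, 0x144f5c%num); (1, 0x2c650%num); (2, 0x1af12%num); (3, 0xb210d%num);
    (1, 0x18c43%num); (3, 0xd0bf0%num); (3, 0x18feb%num); (0, 0x18f06e%num); (0, 0x196085%num)]
    [::
    0x7bfdffffbbfffbbfffbfffffbffffbfffffffffffffffff%num;
    0x6fffeeffff6fffb7ffeffffedffffffffbffffffffffffff%num;
    0x4ffb7ffbbfffbfffffbffffffffeffffffffffdffffffff%num;
    0x21ffe6ffffbffffdffffdbfff7ffffeffffefffffffffffff%num]);
  Some (Sample 4
    [::
    (Pair, (2, 0, 0)); (Pair, (2, 2, 0)); (Pair, (0, 2, 0)); (Pair, (3, 1, 2));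
    (Pair, (1, 3, 2)); (Pair, (3, 3, 2)); (Square, (1, 0, 0))]
    [::
    (3, 0xedf8b%num); (0, 0x6d569%num); (1, 0x3156b1%num); (1, 0x38e5dc%num); (1, 0x115366%num)]
    [::
    0x6ffe63d7fafff7fff8dffccfbff7ffeffff1bffbffffffffdfffebdfffffffffffffffffffffffffffffffff%num;
    0x77bffffffffdfff816fffffffffffdfff8f7fffffffffffdffffffffddbfeffffffffffffffffffffffffff%num;
    0x5dfd3b7fdffebfff9fefe9dbfefff7fffcff7feedff7ffffffeb7bfffffffffffffffffffffffffffffffff%num;
    0x403b7fcffefffffff8da3fdffbffbffffffeb79ff7feffefffffffffffdffffffffeffffffffffffffffffffff%num]);
  Some (Sample 4
    [::
    (Pair, (2, 2, 0)); (Pair, (2, 0, 0)); (Pair, (2, 2, 0)); (Pair, (1, 3, 2));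
    (Pair, (1, 3, 2)); (Pair, (0, 2, 0)); (Square, (3, 0, 0))]
    [::
    (2, 0x715%num); (0, 0x2a1c26%num); (1, 0xaa564%num)]
    [::
    0x3f22fffff43ffffffffd0ffffffffffffb83fcffbcefffeff7dfff1ffffffdff9ffffffdfffffffeffbfdf9dcb7f7ffff2fffdf7effffffdf7efffffff%num;
    0x40000000001777c7fdefbf7fe7fdefbf7ff7ff0bd3e77e7fbfd3ffffffcffffff7fff9ffffffffffffffffa7a7fd3fffe7ffffffffffffffffffffffffffffff%num;
    0x847ba0ffffff91fffffffff23ffffffffffffb71fe7fbe7dbefeffffefe7fbefdfffe7fbefdfffeffffeffbffe7ddbfbfdf7f6ffffffff7fffffffff7fffff%num;
    0x400000061d8ef7f3fdf7eff7f3fdf7eff7f7ff0be9e9ff4ffff9fff7ffa7fff7ffffe9fffffffffffffffcf9ff9ffff4ffffffffffffffffffffffffffffffff%num]);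
  Some (Sample 4
    [::
    (Pair, (3, 1, 2)); (Pair, (1, 3, 2)); (Pair, (3, 1, 2)); (Pair, (2, 2, 0));
    (Pair, (0, 0, 0)); (Pair, (1, 1, 2)); (Square, (3, 0, 0))]
    [::
    (0, 0x14786%num); (2, 0x64325a%num)]
    [::
    0x300000305000c005c0143c000c24fc90f5f0fffffff002d0ffc3d43f24fffcffafffffffffffc3c9cb7fc3cb57ff2d0fffb4f5fffedaffc3ff3f2dffffffffaf2dffb7fff0ffffd7ffffffffffff%num;
    0x40000804000018061033c47c1faaef55c5f8fff3792aaff8fe40ef93ff7fe79fff6bffefd553ebffff3fbfffffdff3fdbff7ffff7fcff67ffddffbff7ffe7f7ffeffdff3ffefffffeffffeff%num;
    0x90000001400240c3c0055c00240cfc3d43f24ffffff00af2dfc00fff0ffffd7fe4ffffffffffc9c3c3ffcb43cfff0f2dfebd73fffafedffb7fff0fffffffffed0ffc3ff3f2dfffcfffffffffffff%num;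
    0x8080015c20000e02101c422aa038fc47cf93fe2fe51f07e7ffdff1fe7ffcdecffdffff5fff3eaaa7fffdff3fdffcfefffcfffbffcfefffdffbfe7ffdfffffbfe7fb3ffeeffdffbffffdeffff%num]);
  Some (Sample 2
    [::
    (Pair, (0, 1, 0)); (Pair, (0, 1, 0)); (Pair, (0, 0, 0)); (Pair, (1, 1, 0));
    (Pair, (1, 0, 0)); (Pair, (0, 1, 0)); (Square, (0, 0, 0))]
    [::
    (1, 0x6531280b1%num)]
    [::
    0x4010104401431c50c3713cfc002113d2e921bb9639fc4f3ff7fffff9059ed92187e5befa187d4b2fd7ffdfbebb79eefdf77ffffffff77ffff557f66fdbbfbeeffeefefbbf7ddffffefbffdffff7fffffffffffffffffffffffffffffffffffffefffffffffffffffffff%num;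
    0x112410215252e921bb90051cf1430dc4f3fcbbc86ee5f77f7fd50319bc2ed219998bb48666df77efff9efff7fffdfffffffffeffffffbef9effe3bffdfffefbffdffff7ffffffbbfbeefdf77fffffffffffffffffffffffffffffffffffffffffffffffffffffff%num])].

(** In degrees 3 to 7 the numbers of quadrics are 35, 22, 17, 15, 14 and, for vanishing, 35, 23, 18,
    16, 15; in degree 8 it is 14. As 13 is odd, one variable is left unpaired and forms a [Square]
    factor. *)
Lemma good_table_13_2 : good_table 13 2 inj_13_2 surj_13_2.
Proof. by vm_compute. Qed.

Definition inj_9_3 : seq sample := [::
  Sample 3
    [::
    (Cube, (1, 2, 0)); (Cube, (0, 0, 0)); (Cube, (0, 0, 0)); (Cube, (1, 2, 0));
    (Cube, (0, 0, 0)); (Cube, (0, 0, 0)); (Cube, (0, 0, 0)); (Cube, (2, 1, 0));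
    (Cube, (2, 1, 0))]
    [::
    (0, 0x189d42020c8c20%num); (0, 0x88cc040d1fa60%num); (0, 0x1101948b53001%num);
    (1, 0x1b08502011403%num); (0, 0x63ba6a3421285%num); (1, 0x54822056a1ec7%num);
    (1, 0x427240b1c1084%num); (2, 0x69914431b40c2%num); (2, 0x30c81081a8a60%num);
    (2, 0x461005b668c40%num); (1, 0x88018e122bc%num); (2, 0xc054a515262a%num);
    (1, 0x8124405811d%num); (0, 0x834424a009f9%num); (0, 0x26342b24c23840%num);
    (2, 0x5469100aa16c9%num); (0, 0x21878942666423%num); (1, 0xe09ae65305c0%num);
    (2, 0x5108e40030b02%num); (1, 0x2650d21c69c5a%num); (0, 0x10318ce6460ab9%num);
    (2, 0xb49490115313%num); (2, 0x27580ac01b52e%num); (1, 0x2aab417118948%num);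
    (2, 0x388421c889498%num); (1, 0x24881aa00f467%num); (0, 0x2c27801850aa62%num);
    (0, 0x18e32b7c24e4e1%num); (2, 0x42a01450bc240%num); (2, 0x25b9185b021b%num);
    (2, 0x5087e0231338e%num); (1, 0xae0d45ab8071%num); (0, 0x1452c0301aa567%num);
    (1, 0x510002c0d25a0%num); (1, 0x540801bcb5091%num); (1, 0x360e02c003209%num);
    (0, 0x8a01818068066%num); (0, 0x766a7a1a903c%num); (1, 0x61598340d4950%num);
    (2, 0x76000a60ab480%num); (0, 0xc980f88890886%num); (2, 0x7891711e880%num);
    (2, 0x60e1a85008f70%num); (2, 0x720d2a4827a44%num); (1, 0x4daf08c00063b%num);
    (1, 0x3ac9010c6a5c3%num)]
    [::
    0x3fffffffffffffffffffffffffffffffff%num; 0xfffffffffffffffffffffffffffffffffff%num;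
    0xfffffffffffffffffffffffffffffffffff%num];
  Sample 9
    [::
    (Cube, (5, 1, 0)); (Cube, (7, 5, 0)); (Cube, (3, 6, 0)); (Cube, (6, 3, 0));
    (Cube, (0, 0, 0)); (Cube, (1, 2, 0)); (Cube, (1, 2, 0)); (Cube, (4, 8, 0));
    (Cube, (7, 5, 0))]
    [::
    (5, 0xf72a%num); (8, 0x1aa6f%num); (5, 0xe431%num); (2, 0x300ee%num); (0, 0x5fb9%num);
    (5, 0x35a12%num); (6, 0x3ee41%num); (7, 0x305a%num); (7, 0x5a27%num); (6, 0x79aff%num);
    (2, 0x6cd6d%num); (2, 0x198e8%num); (1, 0x2c8c%num); (1, 0xded3%num); (1, 0x4b83%num);
    (8, 0x47eb0%num); (0, 0x14f42%num); (1, 0x58ad%num); (7, 0xb8c%num)]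
    [::
    0x3ffffffffffffffffffffffff%num; 0x3fffffffffffffffffffffff%num;
    0xfffffffffffffffffffffff%num; 0x1fffffffffffffffffffffffff%num;
    0xffffffffffffffffffffffff%num; 0xffffffffffffffffffffff%num;
    0x7ffffffffffffffffffffffff%num; 0x7fffffffffffffffffffffff%num;
    0xfffffffffffffffffffffff%num];
  Sample 7
    [::
    (Cube, (4, 1, 0)); (Cube, (5, 3, 0)); (Cube, (3, 6, 0)); (Cube, (2, 4, 0));
    (Cube, (1, 2, 0)); (Cube, (3, 6, 0)); (Cube, (3, 6, 0)); (Cube, (0, 0, 0));
    (Cube, (6, 5, 0))]
    [::
    (2, 0xe2b104%num); (1, 0x2b2822%num); (3, 0x12121%num); (2, 0x20a504%num);
    (1, 0x280c20%num); (5, 0x10492%num); (6, 0x2a0806%num); (1, 0xa0a13%num);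
    (3, 0x220598%num); (4, 0x20b13%num)]
    [::
    0x1bfffffffffefffffbbffff7f7ffffffffffffffffffffffffffffff%num;
    0x3fffffbffffffffffdfdfff7ffffffffffffffffffffffffffffffff%num;
    0xbffffefffffbbfffdffffffffffefffffffffffffffffffffffffff%num;
    0x2fffffffffff7f7ffffffffffffff7f7ffefffffffffff7ffffffffff%num;
    0xfffffceffff7ffffeffffffffffdfffffdfffffbffffffffffffffff%num;
    0x3bffff7f7ffffffffffffffffffffffffdfffffdffffffffffffffff%num;
    0x37f7ffdfffffbffffffffffbbfffffffffffffffffffffffffffffff%num];
  Sample 11
    [::
    (Cube, (0, 0, 0)); (Cube, (2, 4, 0)); (Cube, (0, 0, 0)); (Cube, (7, 3, 0));
    (Cube, (8, 5, 0)); (Cube, (10, 9, 0)); (Cube, (3, 6, 0)); (Cube, (4, 8, 0));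
    (Cube, (2, 4, 0))]
    [::
    (6, 0x7c30%num); (4, 0x68fd%num); (7, 0x3c9d%num); (1, 0x1798%num); (10, 0xa3c%num)]
    [::
    0x6ff7ffeffbfdfffffffff7fff7ffffffffffffffffffffff%num;
    0x3ff7fffffddfffffffffdfffffffff7fdffffffffffffff%num;
    0x16b7fbffffeffffffffbffb7ffbffff7ffffffffffffffff%num;
    0x6edfffdfffffeffffffdfffffffffffdffffffffffffffff%num;
    0x1f5fffffffb7bffffffdfdff7ffffffffffffffffffffff%num;
    0xefedffefff7efffefffffdfffffffffffffffffffffffff%num;
    0xbfbfffdffffefffffffffdfffffffffbfffffffffffffff%num;
    0x3f3feffffddfdbffdfffbfffffffffeffffffffffffffff%num;
    0xef3dfffffbfbfffdfffdfffffffffffffffffffffffffff%num;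
    0x1fefffffff7f7fdffffffeffffffff7ffffffffffffffff%num;
    0x1d7fffffffdefbfffff7f7fffffffffbfffbffffffffffff%num];
  Sample 12
    [::
    (Cube, (10, 8, 0)); (Cube, (8, 4, 0)); (Cube, (4, 8, 0)); (Cube, (6, 0, 0));
    (Cube, (1, 2, 0)); (Cube, (7, 2, 0)); (Cube, (3, 6, 0)); (Cube, (0, 0, 0));
    (Cube, (9, 6, 0))]
    [::
    (7, 0x1ff2%num); (1, 0x1ffd%num); (5, 0x1efa%num)]
    [::
    0x2effffdfffffdffffaff7fffffbff7ffffffffffffffffffffffff%num;
    0x2e7cfffffffe7fffffffff7feffffefffffffffffffffffffffffffff%num;
    0x2d7fdf77ffffdfffdfff8fffffffffffbfffffffffffffffffffff%num;
    0x13fff9ffffffffffffbf7dfffffffbffffffffffffffffffffffffff%num;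
    0x21fdbffffefddffffffdfffbdffffffffffbffffffffffffffffffff%num;
    0xff6ffcffffcffffffff77fffeffffffffffffffffffffffffffffff%num;
    0x161ffffbfffffeffffafff7ffffff7fffffffffffffffffffffffff%num;
    0xdbe7ffffffcfffffffffdffefffffbffffffffffffffffffffffffff%num;
    0x23ffef6fffffbfffeff3fbffff7fffffffffffffffffffffffffff%num;
    0x19fffb7fffffffffffeefdfffffffeffffffffffffffffffffffffff%num;
    0x21fddffffdfdbfffffff5ffffdfffff7ffffffffffffffffffffffff%num;
    0x7fcffe7fffdbfffffff6ffff7ffffffffffffffffffffffffffffff%num];
  Sample 9
    [::
    (Cube, (5, 1, 0)); (Cube, (0, 0, 0)); (Cube, (3, 6, 0)); (Cube, (1, 2, 0));
    (Cube, (6, 3, 0)); (Cube, (2, 4, 0)); (Cube, (7, 5, 0)); (Cube, (6, 3, 0));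
    (Cube, (8, 7, 0))]
    [::
    (5, 0x1fedc%num); (6, 0xffff%num)]
    [::
    0x4b7fe5fffbf7cfffff7ffffffbbfffbffffff3fffffffffffffffffffffffffffffffffffffffffffffffff%num;
    0xdf7c8ffeffadfffffefffffb9fefffffdfffdfffffffffffffffffffffffffffffffffffffffffffffffff%num;
    0x3be36ff7fff7dfe7fffffff2fffdffffffff7ffffffffffffffffffffffffffffffffffffffffffffffffff%num;
    0xfaacf7c7fff7fefffff7fe3ffbfffffffffffffff7fffffffffffffffffffffffffffffffffffffffffffff%num;
    0x8abeb5fffffff77fff7fffbfffffbf9fffffff7fffffffffffffffffffffffffffffffffffffffffffffff%num;
    0x5ffefbfcfff73fdfffffbfbe7ffffbfffffeffffffffffffffffffffffffffffffffffffffffffffffffff%num;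
    0x23fb9effdffc3fff7fffffeb7fffffbffffffffefffffffffffffffffffffffffffffffffffffffffffffff%num;
    0x572bfff9df8ffeffffffffefbfcfffffffdfffffffffffffffffffffffffffffffffffffffffffffffffff%num;
    0x1a8fffb9feefffffefe7fffbff7ffffbfffffffffffffffffffffffffffffffffffffffffffffffffffffff%num];
  Sample 5
    [::
    (Cube, (1, 2, 0)); (Cube, (1, 2, 0)); (Cube, (2, 4, 0)); (Cube, (4, 3, 0));
    (Cube, (4, 3, 0)); (Cube, (0, 0, 0)); (Cube, (0, 0, 0)); (Cube, (3, 1, 0));
    (Cube, (2, 4, 0))]
    [::
    (4, 0x34ef3f54%num)]
    [::
    0xfffffffffffffffffffffffffffffffffffffffffffffffffffffffffffffffffffffffffffffffffffffffffffffffffffffffffffffffffff%num;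
    0x1fffffffffffffffffffffffffffffffffffffffffffffffffffffffffffffffffffffffffffffffffffffffffffffffffffffffffffffffffff%num;
    0x1fffffffffffffffffffffffffffffffffffffffffffffffffffffffffffffffffffffffffffffffffffffffffffffffffffffffffffffffffff%num;
    0x1fffffffffffffffffffffffffffffffffffffffffffffffffffffffffffffffffffffffffffffffffffffffffffffffffffffffffffffffffff%num;
    0x1fffffffffffffffffffffffffffffffffffffffffffffffffffffffffffffffffffffffffffffffffffffffffffffffffffffffffffffffffff%num]].

Definition surj_9_3 : seq (option sample) := [::
  None;
  Some (Sample 7
    [::
    (Cube, (5, 3, 0)); (Cube, (0, 0, 0)); (Cube, (4, 1, 0)); (Cube, (2, 4, 0));
    (Cube, (4, 1, 0)); (Cube, (1, 2, 0)); (Cube, (3, 6, 0)); (Cube, (3, 6, 0));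
    (Cube, (2, 4, 0))]
    [::
    (3, 0x2655f8%num); (1, 0xeb99ba%num); (3, 0x52ffc%num); (6, 0xad8ed%num);
    (2, 0x66ed02%num); (1, 0x1d328a%num); (0, 0x155e3b%num); (5, 0xfecbd%num);
    (4, 0x48d82e%num); (0, 0xbffea%num); (6, 0x1519a3%num); (1, 0x450333%num);
    (3, 0x3cd965%num); (3, 0x59528c%num); (2, 0x2ac6ee%num); (6, 0x1e9b0d%num);
    (3, 0xaf2b4%num); (5, 0xb046b%num); (2, 0xa4289%num); (5, 0x69761%num)]
    [::
    0xafffffffffffffffffffffffffffffff%num; 0xffffffffffffffffffffffffffffffff%num;
    0x7fffffffffffffffffffffffffffffff%num; 0xbfffffffffffffffffffffffffffffff%num;
    0x1fffffffffffffffffffffffffffffff%num; 0x1fffffffffffffffffffffffffffffff%num;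
    0xfffffffffffffffffffffffffffffff%num]);
  Some (Sample 9
    [::
    (Cube, (3, 6, 0)); (Cube, (2, 4, 0)); (Cube, (6, 3, 0)); (Cube, (6, 3, 0));
    (Cube, (0, 0, 0)); (Cube, (2, 4, 0)); (Cube, (7, 5, 0)); (Cube, (5, 1, 0));
    (Cube, (1, 2, 0))]
    [::
    (4, 0x1f740%num); (7, 0x384%num); (4, 0xe2ec%num); (8, 0x6f94%num); (5, 0xee528%num);
    (3, 0x71f5%num); (3, 0x34b1%num); (2, 0x289%num); (0, 0xdbf1%num); (7, 0xdf74%num);
    (1, 0x10d1e%num)]
    [::
    0x1000ffffffffddfffffffffff77fffffffffffffffffffff%num;
    0x1febfffffffeffff7fff7ffffffffffffffffffffffff%num;
    0x4fe7ddffdffffffffdfffeffffffffffff7ffff7ffffff%num;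
    0x15576ffff5fffbffffffffffffdfffddffffffffffffffff%num;
    0x377ffbbffbfffffffffffffdfffffffffffffffffffff%num;
    0x83afffdfffebfffffffffffffffffffffffff7fffffff%num;
    0x89b6bdffffffff77ff7fffffffffffeffffffffffffffff%num;
    0x47eedffffbfffd7fffbbffeefffffffffffffffffffffff%num;
    0x1ffffbfffbffff7ffff7ffffffffffffeffffffffffff%num]);
  Some (Sample 10
    [::
    (Cube, (1, 2, 0)); (Cube, (7, 4, 0)); (Cube, (0, 0, 0)); (Cube, (5, 0, 0));
    (Cube, (8, 6, 0)); (Cube, (3, 6, 0)); (Cube, (6, 2, 0)); (Cube, (4, 8, 0));
    (Cube, (2, 4, 0))]
    [::
    (1, 0x757b%num); (1, 0x19a7%num); (6, 0xce1a%num); (2, 0x516%num); (8, 0xc826%num);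
    (0, 0xca2b%num)]
    [::
    0x9ffffffffbfdfffebfff7fff5fffffdefffffffffbfffffffffffffffffff%num;
    0x4a7ffffffddffbff7ffe6ffffffffdbffffffffffffffffffffffffffffff%num;
    0x897fffafff95ffffffffffbffffffffff5fffffffffeffffffffffffffffff%num;
    0x7fbff7ffcbfffffffffdafffffffdbfffffffffffffffdffffffffffffff%num;
    0x6ffffffffdd77fffffff7fffffd7ffffffebfffff7fffffffffffffffffff%num;
    0x2bfbfffffd9fffff7ffddffbfffffeeffffffffefffffffffffffffffffff%num;
    0x1bfffffff3fffafffffed7fffffffffffffffffff7fffffffffffffffffff%num;
    0x7ffffdfff9bfeffffff6ffffffffffebffffffffdfffffffffffffffffff%num;
    0x2d76bfffffedffffffffffaeffffffffffffffafff7fffffffffffffffffff%num;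
    0x2ffbff7fffdafffffffd9fffff7ffddfffffffffffff7ffffffffffffffff%num]);
  Some (Sample 11
    [::
    (Cube, (6, 1, 0)); (Cube, (2, 4, 0)); (Cube, (3, 6, 0)); (Cube, (9, 7, 0));
    (Cube, (1, 2, 0)); (Cube, (10, 9, 0)); (Cube, (8, 5, 0)); (Cube, (6, 1, 0));
    (Cube, (0, 0, 0))]
    [::
    (1, 0x275d%num); (2, 0x110e%num); (7, 0x6dbd%num); (6, 0x4d2%num)]
    [::
    0x20fdbbfffffff7e6ffcffffdffffffff5bffffdfffdfffeffffff7ffffffffffffffffff%num;
    0x15df77efffffef79ffeffdff6fffffffe4bfbffdffffffbfbffffffffffffffffffffffff%num;
    0x1fedf7fffffdedfbfffdfdf77ffffffb6fdfe7fffffff7ffffffffffffdffffffffffff%num;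
    0x35e3fffff7fecdffdfff7fedffffffff3f7fff6fffffffffffffffffffffffffffffffff%num;
    0x2dfaffdfffbd74fff7fffff9ffffffff6ffb7fddffffdffffeffffffffffffffffffffff%num;
    0xdfbfbfbfffeb73fffbffffeffdfffff7fbbf6fffdfffffffffffffffffffffffffffff%num;
    0x16fdef7fffffc9bf7ffbffffff7f7ffffcfdbff3fffb7ffffffffffffffffffffffffffff%num;
    0x8000001beffffffff4cfbfefffffffeffffffee79fdeffdff6fffffffffffffffffffffffffff%num;
    0x156eefffff7ff8dbfffb7fffffffffffdeffbfbfdfd77fffffffffffffffffffffffffff%num;
    0xfef3efffeffb6edbfeeffffefffff7ff67ffefffbff7ffffffffffffffffffffffffffff%num;
    0x97f7ffefffff7abbf6fffffbffffeff7d3ffdfffffefffffffffdffffffffffffffffff%num]);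
  Some (Sample 12
    [::
    (Cube, (8, 4, 0)); (Cube, (0, 0, 0)); (Cube, (8, 4, 0)); (Cube, (10, 8, 0));
    (Cube, (3, 6, 0)); (Cube, (5, 10, 0)); (Cube, (7, 2, 0)); (Cube, (9, 6, 0));
    (Cube, (10, 8, 0))]
    [::
    (4, 0x1fb6%num); (7, 0x173%num); (1, 0x1b17c%num)]
    [::
    0x40000000804203efff7fbea0c45f7e6b7df2fc4befff7dfcf7feffffffffffffffffffffffffff7ffffffff%num;
    0x200000100b7edfffff2afeefad3ff7ff7ffbbebf5ffabebfff7ffffffffffffffffffffffffffffffff%num;
    0x4204026601443dbff45996ffd37cffdbfcb7ffe9ffcffffffffffffffffffffffffefffffffffffffff%num;
    0x200000cffeff7fffeabbb2775befb77ffd90ffdf7eb1ffeffffffffffffffffffffffffffffffff%num;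
    0x4000000000400226016403ffff458afff9b7dffafff9efffefbd7fffdfffddffffffffffffff7fbffffffffffffff%num;
    0x244048483d9ff7dfff62632ffeab6bfdff80ebff2bff77ffff7ffffffffffffffffffffffffffffff%num;
    0x20000000000024000ffffbfffff0ef5bfccbffbdffe77fbf7777fbfdfebfb7ffffffffffffefffffffffffffff%num;
    0x8008003002ae801dff61177fbf924fff7df8faffe3ff8fbfffffffffffffffffffffffff7ffdfffffffff%num;
    0x8000004083ffbfffdfff3ddeb7ddfedf7fffadf7dbf9f7dfffeeffffffffffffffffffffffffffffff%num;
    0x2000000000001000010200427006eff8bf37bfe4bfff9aff43fffe7fffbffffdfffffffff5fffffffff7ffbffffffffff%num;
    0x40000426b7fb7fff96b6db9ed6fbfff786f4fff3f9affffffffffffffffffffffffffffffffffffff%num;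
    0x160008767fffff4cff7ffcff7ff77ff3ffecbffabfdffdffffffffb7fffffffffffffffffffffff%num]);
  Some (Sample 8
    [::
    (Cube, (0, 0, 0)); (Cube, (5, 2, 0)); (Cube, (3, 6, 0)); (Cube, (0, 0, 0));
    (Cube, (1, 2, 0)); (Cube, (1, 2, 0)); (Cube, (6, 4, 0)); (Cube, (7, 6, 0));
    (Cube, (1, 2, 0))]
    [::
    (3, 0x80461%num); (1, 0x16d6d2%num)]
    [::
    0x80005001003d24012800217fff8000f028a9c006efbffffffbff97fffbfffffbfc8777fe9fe43ffc78fc17fbffe5fffd36ff8bfa3fe9ff8ffffffffedf0bfdfffffa7dffffff%num;
    0x2794d03afffc00000202067c889f7ffffee7ff347fffff7fffffa1fc7ffd7dfe1effe9b77fefe87ff81dbe2fbff9fff7fffdbdffbffffd3ceffa7f9ffff%num;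
    0x1000010002b3f9e9605fffe00000281c200ff5ff6ffffebdfeffbf97fffffdc0f7f357fff9effd3e7fa1b72ff0bfdfffff43e7c5ffbffe7fdbffffffc36e5fffeffffffff%num;
    0x120000034005470003ff770000054d02fa08dd7dfdbffdfffd1fffdfffffbdfa71ef77f4ffc5fa1fffff4f3bfe9f8f1f82ff7ffcbffffffffcf7ffa1a7dfffffdbff%num;
    0x1000000002c44b8036b3fcfe0020006f280b37ffffbffe5f7fbfffef7bfffff9a7fa1ff6ffff82fbfebdffa7f0db97fffe1effe9b77feffdfffdbff90f9fe9effdfffffff%num;
    0x180005804d4a6801faf80004009acfe781e97fffbffffe5ffbffb7fffffc7ff7aa1ffff8bfa3fe9fd0d3efffe9f3fd0db97fc5fefffffd3effff0ffb7ffffffef%num;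
    0x801e90000000001012e001fb7ffe021a006a39093efebbfffe09fc5ffffffdfff7bffbfe07aff57fc0edf17dffcff90f9fe9eff8bf43ffffedf77ffffcffe5fffd36ffe7bfffff%num;
    0x1200000140e105e7bffa00000000b112e06dbeb7bf97fffffeddffffefffded5e9ffdf9a7a1f3e2ffdffc3fedfe0beffaf7fe9ff3ee5fffeffffff7f43ffedfffff%num]);
  Some (Sample 5
    [::
    (Cube, (4, 3, 0)); (Cube, (0, 0, 0)); (Cube, (1, 2, 0)); (Cube, (0, 0, 0));
    (Cube, (2, 4, 0)); (Cube, (4, 3, 0)); (Cube, (2, 4, 0)); (Cube, (3, 1, 0));
    (Cube, (1, 2, 0))]
    [::
    (4, 0xdfb7f4aa%num)]
    [::
    0x46c00058484c2bc0052520003fbe6effff27b5eff6ffff7fffff1c1fbfdbdffdffffffffffdfffffff7ffffffffffffffffffffbfbfffeffffffffffffffffffffffffffffffff%num;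
    0x100084a40805f740018ec085ac7eb5ffef84efefbdffffffffffaebf4bfbfbfdffffefff7fbdf7fbfdffffffffffffffffffffffffffffffffffffffffffffffffffffffffffff%num;
    0x1200010c81095a6c01a80c018fa6e4fffffabdaf3f5ffffffffff5e7ebfcdfdf97fffffffffbff7ffff7fffffffffffffffffffeffffffffffffffffffffffdffffffffffffffff%num;
    0x400900600865370002130242b9bd7fffdf0a77fefffffffffffe613bffff37fbfffffffaffffffdbffffffffffffffffffffffffefffffffffffffffffffffffffffffffffffff%num;
    0x2000002130b4038bc201036021beaf5bdfff8dcfbee9ffffffffff7816d7bfcfffffffffff3fffbfffffffffffffffffffffffffffffffffffffffffffffffffffffffffffffffff%num])].

(** In degrees 4 to 10 the numbers of cubics are 55, 28, 19, 14, 12, 11, 10 and, for vanishing, 55,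
    29, 20, 15, 13, 12, 11; in degree 11 it is 10. *)
Lemma good_table_9_3 : good_table 9 3 inj_9_3 surj_9_3.
Proof. by vm_compute. Qed.

Theorem theorem1 (k : fieldType) (chark : [pchar k] =i pred0)
    (d n r : nat)
    (hdn : (d, n) \in [:: (2, 12); (2, 13); (3, 9)]%N)
    (hr : (0 < r)%N) :
  @generic_forms k n d r (fun f : 'I_r -> {mpoly k[n]} =>
    is_hilbert_series (in_ideal f)
      (bracket (fps_div (fps_of_poly ((1 - 'X^d) ^+ r))
                        (fps_of_poly ((1 - 'X) ^+ n))))).
Proof.
move: hdn; rewrite !inE => /or3P[] /eqP[-> ->].
- exact: (@froberg_good_table 12 2 k chark isT isT _ _ good_table_12_2 r).
- exact: (@froberg_good_table 13 2 k chark isT isT _ _ good_table_13_2 r).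
- exact: (@froberg_good_table 9 3 k chark isT isT _ _ good_table_9_3 r).
Qed.
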